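(* Consider a scale model $p_\theta(x)=\frac1\theta p\left(\frac x\theta\right)$, $x\in\mathbb R$, $\theta\in\Theta\subset(0,\infty)$, for a given density $p$ on $\mathbb R$ with derivative $\dot p$, and the Cressie-Read divergence with index $\gamma\in\mathbb R\setminus\{0\}$. Let $\alpha,\theta_0\in\Theta$ and suppose that (A.1) $\int|u\,\dot p(u)|\,du<\infty$; (A.4) $\displaystyle\sup_x\left|\frac{\partial}{\partial\theta}\left[\log p(\theta_0^{-1}x)\right]\left(\frac{p(\alpha^{-1}x)}{p(\theta_0^{-1}x)}\right)^{\gamma}\right|<\infty$, where $\frac{\partial}{\partial\theta}[\log p(\theta_0^{-1}x)]$ denotes the derivative of $\theta\mapsto\log p(\theta^{-1}x)$ at $\theta=\theta_0$; and that moreover (A.2) $\displaystyle\sup_x\frac{p(\alpha^{-1}x)}{p(\theta_0^{-1}x)}<\infty$, in the case $\gamma>0$, or (A.3) $\displaystyle\sup_x\frac{p(\theta_0^{-1}x)}{p(\alpha^{-1}x)}<\infty$, in the case $\gamma<0$. Then the dual $\phi$-divergence estimator $\widehat\theta_n(\alpha)$ is B-robust, i.e. $\sup_x|\mathrm{IF}(x;T_\alpha,P_{\theta_0})|<\infty$.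
   Context: Cressie-Read divergences: for $\gamma\in\mathbb R\setminus\{0,1\}$, $\varphi_\gamma(x)=\frac{x^\gamma-\gamma x+\gamma-1}{\gamma(\gamma-1)}$ for $x>0$; $\varphi_0(x)=-\log x+x-1$; $\varphi_1(x)=x\log x-x+1$. Let $\varphi=\varphi_\gamma$. $P_\theta$ is the probability measure with density $p_\theta$ (with respect to Lebesgue measure), the model is identifiable, and $\theta_0$ is the true parameter value. Put $$m(\theta,\alpha,x)=\int\varphi'\left(\frac{p_\alpha}{p_\theta}\right)dP_\alpha-\left\{\varphi'\left(\frac{p_\alpha(x)}{p_\theta(x)}\right)\frac{p_\alpha(x)}{p_\theta(x)}-\varphi\left(\frac{p_\alpha(x)}{p_\theta(x)}\right)\right\}.$$ For every $\alpha$, $\theta\mapsto\int m(\theta,\alpha)\,dP_{\theta_0}$ has the unique maximizer $\theta_0$. With $P_n$ the empirical measure of an i.i.d. sample, $\widehat\theta_n(\alpha)=\arg\sup_{\theta\in\Theta}\int m(\theta,\alpha)\,dP_n$, and the corresponding functional is $T_\alpha(P)=\arg\sup_{\theta\in\Theta}\int m(\theta,\alpha,y)\,dP(y)$. Standing assumptions (with $m',m''$ the first and second derivatives of $m$ in $\theta$): for each $\alpha$, $\theta\mapsto m(\theta,\alpha)$ is twice continuously differentiable; $\int m''(\theta_0,\alpha)\,dP_{\theta_0}$ exists and is non-zero; and the first and second derivatives of $\theta\mapsto m(\theta,\alpha)$ are dominated on some neighborhoods of $\theta_0$ by $P_{\theta_0}$-integrable functions (which justifies interchanging differentiation in $\theta$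 and integration). The influence function of a functional $T$ at $P$ is $\mathrm{IF}(x;T,P)=\lim_{\varepsilon\to0}\frac{T((1-\varepsilon)P+\varepsilon\delta_x)-T(P)}{\varepsilon}$, with $\delta_x$ the Dirac measure at $x$. An estimator with functional $T$ is called B-robust if its gross error sensitivity $\sup_x\|\mathrm{IF}(x;T,P)\|$ is finite (here at $P=P_{\theta_0}$). *)

(* Defs.v *)
From HB Require Import structures.
From mathcomp Require Import all_boot all_order all_algebra.
From mathcomp Require Import all_classical all_reals all_analysis.
Set Implicit Arguments.
Unset Strict Implicit.
Unset Printing Implicit Defensive.
Import Order.TTheory GRing.Theory Num.Theory.
Import numFieldNormedType.Exports.
Local Open Scope ring_scope.
Local Open Scope classical_set_scope.

Section divergence.
Context {R : realType}.

(* Only the values at x > 0 are meaningful. *)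
Definition cressie_read (gamma x : R) : R :=
  if gamma == 0 then - ln x + x - 1
  else if gamma == 1 then x * ln x - x + 1
  else (x `^ gamma - gamma * x + gamma - 1) / (gamma * (gamma - 1)).

Definition scale_density (p : R -> R) (theta x : R) : R :=
  theta^-1 * p (theta^-1 * x).

(* phi' at the density ratio p_alpha / p_theta *)
Definition dphi_ratio (phi : R -> R) (q : R -> R -> R) (theta alpha x : R) : R :=
  derive1 phi (q alpha x / q theta x).

Definition dual_m (phi : R -> R) (q : R -> R -> R)
    (P : R -> probability (measurableTypeR R) R) (theta alpha x : R) : R :=
  Rintegral (P alpha) setT (dphi_ratio phi q theta alpha)
  - (dphi_ratio phi q theta alpha x * (q alpha x / q theta x)
     - phi (q alpha x / q theta x)).

(* The integral is taken in the extended reals, so -oo is an allowed value. *)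
Definition dual_criterion (m : R -> R -> R -> R) (alpha : R)
    (Q : probability (measurableTypeR R) R) (theta : R) : \bar R :=
  (\int[Q]_y (m theta alpha y)%:E)%E.

End divergence.

Section argsup.
Context {R : realType}.

Definition is_argsup (Theta : set R) (f : R -> \bar R) (t : R) : Prop :=
  Theta t /\ forall s, Theta s -> (f s <= f t)%E.

Definition is_unique_argsup (Theta : set R) (f : R -> \bar R) (t : R) : Prop :=
  is_argsup Theta f t /\ forall s, is_argsup Theta f s -> s = t.

(* T is a determination of T_alpha : Q |-> argsup over Theta of
   theta |-> \int m(theta, alpha, y) dQ(y).  Its value at Q is unconstrained
   when the supremum is not attained. *)
Definition is_dual_functional (Theta : set R) (m : R -> R -> R -> R) (alpha : R)
    (T : probability (measurableTypeR R) R -> R) : Prop :=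
  forall Q, (exists t, is_argsup Theta (dual_criterion m alpha Q) t) ->
    is_argsup Theta (dual_criterion m alpha Q) (T Q).

End argsup.

Section contamination.
Context d {X : measurableType d} {R : realType}.
Variables (P Q : probability X R) (w : {i01 R}).

Definition mixture : set X -> \bar R :=
  measure_add (mscale ((1 - w%:num)%:nng) P) (mscale (w%:num%:nng) Q).

HB.instance Definition _ := Measure.on mixture.

Let mixture_setT : mixture setT = 1%E.
Proof.
by rewrite /mixture measure_addE/= /mscale/= !probability_setT !mule1 -EFinD subrK.
Qed.

HB.instance Definition _ :=
  Measure_isProbability.Build _ _ _ mixture mixture_setT.

End contamination.

Section influence.
Context {R : realType}.

Fact clip01_ge0 (e : R) : 0 <= Num.min `|e| 1.
Proof. by rewrite le_min normr_ge0 ler01. Qed.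

Fact clip01_le1 (e : R) : Num.min `|e| 1 <= 1.
Proof. by rewrite ge_min lexx orbT. Qed.

(* equal to e for 0 <= e <= 1 *)
Definition clip01 (e : R) : {i01 R} := Itv01 (clip01_ge0 e) (clip01_le1 e).

Definition contaminate (P : probability (measurableTypeR R) R) (x e : R) :
    probability (measurableTypeR R) R :=
  mixture P (dirac (x : measurableTypeR R)) (clip01 e).

Definition if_quotient (T : probability (measurableTypeR R) R -> R)
    (P : probability (measurableTypeR R) R) (x e : R) : R :=
  (T (contaminate P x e) - T P) / e.

(* The limit is one-sided: (1 - e) P + e delta_x is a probability measure
   only for e in [0, 1]. *)
Definition influence_function (T : probability (measurableTypeR R) R -> R)
    (P : probability (measurableTypeR R) R) (x : R) : R :=
  lim (if_quotient T P x e @[e --> 0^'+]).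

Definition B_robust (T : probability (measurableTypeR R) R -> R)
    (P : probability (measurableTypeR R) R) : Prop :=
  (forall x, cvg (if_quotient T P x e @[e --> 0^'+])) /\
  (ereal_sup (range (fun x => `|influence_function T P x|%:E)) < +oo)%E.

End influence.

Section assumptions.
Context {R : realType}.

Definition has_density (P : probability (measurableTypeR R) R) (f : R -> R) : Prop :=
  forall A : set (measurableTypeR R), measurable A ->
    P A = (\int[lebesgue_measure]_(x in A) (f x)%:E)%E.

(* twice continuously differentiable on the interior of D *)
Definition C2_on_interior (D : set R) (f : R -> R) : Prop :=
  forall t, D° t ->
    [/\ derivable f t 1, derivable (derive1 f) t 1 & {for t, continuous (derive1n 2 f)}].

Definition dominated_near (P : probability (measurableTypeR R) R) (t0 : R)
    (g : R -> R -> R) : Prop :=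
  exists G : R -> R, P.-integrable setT (EFin \o G) /\
    \forall t \near t0, forall x, `|g t x| <= G x.

(* For a fixed alpha, m stands for (theta, x) |-> m(theta, alpha, x). *)
Definition m_regular (Theta : set R) (P0 : probability (measurableTypeR R) R)
    (theta0 : R) (m : R -> R -> R) : Prop :=
  let m' theta x := derive1 (m ^~ x) theta in
  let m'' theta x := derive1n 2 (m ^~ x) theta in
  [/\ (forall x, C2_on_interior Theta (m ^~ x)),
      P0.-integrable setT (EFin \o m'' theta0),
      Rintegral P0 setT (m'' theta0) != 0,
      dominated_near P0 theta0 m' &
      dominated_near P0 theta0 m''].

End assumptions.

(* Main.v *)
Require Import Defs.
From mathcomp Require Import all_boot all_order all_algebra.
From mathcomp Require Import all_classical all_reals all_analysis.
From mathcomp Require Import measurable_realfun ring lra.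
Import Order.TTheory GRing.Theory Num.Theory.
Import numFieldNormedType.Exports.
Local Open Scope ring_scope.
Local Open Scope classical_set_scope.
Set Implicit Arguments.
Unset Strict Implicit.
Unset Printing Implicit Defensive.

(** Let [r_t = p_alpha / p_t]. In terms of the deformed logarithm [qlog], the
criterion function is [m(t, alpha, x) = I t - qlog gamma (r_t x)], where [I t]
does not depend on [x].

If the argsup [t_e] of the criterion under [(1 - e) P_theta0 + e delta_x] exists
and tends to [theta0], then it solves the first-order equation, and expanding
this equation at [theta0] gives
[IF(x) = - m'(theta0, alpha, x) / \int m''(theta0, alpha) dP_theta0]
([cvg_if_quotient]). The derivative [m'(theta0, alpha, x)] differs from its
value at [x = 0] by the difference of two values of the score
[r^gamma (1 + u p'(u) / p(u)) / theta0], where [u = x / theta0], and the score is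
bounded by the assumptions on the ratio and on the weighted logarithmic
derivative ([ratio_score_bounded]).

The main work is to show that the contaminated argsup exists and tends to
[theta0], although [Theta] need not be compact. Let [M] be the criterion at
[P_theta0]. The loss [Delta t = M theta0 - M t] is the integral of a Bregman
divergence between [r_theta0] and [r_t]. Two facts suffice ([criterion_far]).
- Separation ([criterion_separation]): [Delta] is bounded below by a positive
  constant outside every neighborhood of [theta0]. A Bregman divergence is
  bounded below where [p_t / p_theta0] stays away from 1, and
  [density_ratio_away] finds two intervals such that this happens on one of
  them, uniformly in [t].
- Growth ([criterion_growth]): for fixed [x], and wherever [M t] is finite,
  [m(t, alpha, x)] is at most an affine function of [Delta t]. The tangent
  inequality of the divergence function, taken between [s r_theta0] and [r_t],
  bounds the term [I t] by the loss: from above with [s = 2], which settles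
  positive [gamma], and from below with [s = 1/2], for negative [gamma]
  ([bregman_tangent_int]).
So a small mass at [x] cannot compensate the loss at a far parameter.

Both facts need the decay of [p]: [p] is bounded and [u p(u)] tends to 0 at
infinity. This follows from the integrability of [p] and [u p'(u)] by the
fundamental theorem of calculus for [u p(u)] ([density_bounded],
[density_tail]). Its use requires a continuous [p'] away from 0, which is
inherited from the regularity of [m] in the parameter
([continuous_derive1_off0]). *)

(** * The deformed logarithm and the Cressie-Read divergences *)

Section qlog.
Context {R : realType}.
Implicit Types s t a b g : R.

(** The primitive of [t `^ (s - 1)] that vanishes at 1. It carries the whole
Cressie-Read family: [qlog (g - 1)] is the derivative of the divergence
function, and [qlog g] is its Legendre-type companion [x phi' x - phi x]. *)
Definition qlog s t : R := if s == 0 then ln t else (t `^ s - 1) / s.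

Lemma is_derive_qlog s t : 0 < t -> is_derive t 1 (qlog s) (t `^ (s - 1)).
Proof.
move=> t0; rewrite /qlog; have [->|s0] := eqVneq s 0.
  rewrite sub0r powR_inv1 ?ltW//; exact: is_derive1_ln.
have -> : (fun t => (t `^ s - 1) / s) = s^-1 *: ((fun u => u `^ s) - cst 1).
  by apply/funext => u; rewrite [RHS]mulrC.
have H := is_derive1_powR s t0.
apply: is_derive_eq.
by rewrite subr0 /GRing.scale/= mulrA mulVf// mul1r.
Qed.

Lemma qlog1 s : qlog s 1 = 0.
Proof. by rewrite /qlog ln1 powR1 subrr mul0r if_same. Qed.

(** This replaces the additivity of [ln], and is the source of the homogeneity
of the Bregman divergence. *)
Lemma qlogM s a b : 0 < a -> 0 < b -> qlog s (a * b) = qlog s a + a `^ s * qlog s b.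
Proof.
move=> a0 b0; rewrite /qlog; case: eqVneq => [->|s0].
  by rewrite powRr0 mul1r lnM.
by rewrite powRM ?ltW//; field.
Qed.

Lemma powR_qlog s t : s != 0 -> t `^ s = 1 + s * qlog s t.
Proof. by move=> s0; rewrite /qlog (negbTE s0); field. Qed.

Lemma qlog_le_neg s t : s < 0 -> qlog s t <= - s^-1.
Proof.
move=> s0; rewrite /qlog lt_eqF// mulrBl mul1r lerBlDr addNr.
by rewrite mulr_ge0_le0 ?powR_ge0// invr_le0 ltW.
Qed.

Lemma qlog_ge_pos s t : 0 < s -> - s^-1 <= qlog s t.
Proof.
move=> s0; rewrite /qlog gt_eqF// mulrBl mul1r lerBrDr addNr.
by rewrite divr_ge0 ?powR_ge0// ltW.
Qed.

Lemma is_derive_within_continuous (f df : R -> R) a b :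
  (forall t, a <= t -> is_derive t 1 f (df t)) -> {within `[a, b], continuous f}.
Proof.
move=> h; apply: derivable_within_continuous => t; rewrite in_itv/= => /andP[at_ _].
by have [] := h t at_.
Qed.

Lemma mul_powRB1 g a : 0 < a -> a * a `^ (g - 1) = a `^ g.
Proof.
move=> a0; rewrite -{1}(powRr1 (ltW a0)) -powRD ?subrKC//.
by rewrite (negbTE (lt0r_neq0 a0)) implybT.
Qed.

(** The Bregman divergence of the Cressie-Read function between 1 and [t]. *)
Definition qgap g t : R := qlog g t - qlog (g - 1) t.

Lemma is_derive_qgap g t : 0 < t ->
  is_derive t 1 (qgap g) (t `^ (g - 1 - 1) * (t - 1)).
Proof.
move=> t0.
have H1 := is_derive_qlog g t0.
have H2 := is_derive_qlog (g - 1) t0.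
have -> : qgap g = qlog g - qlog (g - 1) by [].
apply: is_derive_eq.
rewrite -(mul_powRB1 (g - 1) t0); ring.
Qed.

Lemma qgap1 g : qgap g 1 = 0.
Proof. by rewrite /qgap !qlog1 subrr. Qed.

Lemma qgap_ndecr g a b : 1 <= a -> a <= b -> qgap g a <= qgap g b.
Proof.
move=> a1 ab.
have p t : a <= t -> 0 < t by lra.
have [| |c] := @MVT_segment _ (qgap g) (fun t => t `^ (g - 1 - 1) * (t - 1)) a b ab.
- move=> t; rewrite in_itv/= => /andP[at_ _].
  by apply: is_derive_qgap; apply: p; exact: ltW.
- apply: is_derive_within_continuous => t at_; apply: is_derive_qgap; exact: p.
rewrite in_itv/= => /andP[ac _] E; rewrite -subr_ge0 E.
by rewrite !mulr_ge0 ?powR_ge0 ?subr_ge0//; lra.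
Qed.

Lemma qgap_nincr g a b : 0 < a -> a <= b -> b <= 1 -> qgap g b <= qgap g a.
Proof.
move=> a0 ab b1.
have p t : a <= t -> 0 < t by lra.
have [| |c] := @MVT_segment _ (qgap g) (fun t => t `^ (g - 1 - 1) * (t - 1)) a b ab.
- move=> t; rewrite in_itv/= => /andP[at_ _].
  by apply: is_derive_qgap; apply: p; exact: ltW.
- apply: is_derive_within_continuous => t at_; apply: is_derive_qgap; exact: p.
rewrite in_itv/= => /andP[ac cb] E; rewrite -subr_le0 E.
by rewrite mulr_le0_ge0 ?subr_ge0// mulr_ge0_le0 ?powR_ge0//; lra.
Qed.

Lemma qgap_ge0 g t : 0 < t -> 0 <= qgap g t.
Proof.
move=> t0; rewrite -(qgap1 g); have [t1|t1] := lerP 1 t.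
  exact: qgap_ndecr.
by apply: qgap_nincr => //; exact: ltW.
Qed.

Lemma qgap_gt0 g t : 0 < t -> t != 1 -> 0 < qgap g t.
Proof.
move=> t0 t1.
have p (u : R) : 0 < u -> is_derive u 1 (qgap g) (u `^ (g - 1 - 1) * (u - 1)).
  exact: is_derive_qgap.
case: (ltgtP t 1) t1 => // t1 _.
- have [| |c] := @MVT _ (qgap g) (fun t => t `^ (g - 1 - 1) * (t - 1)) t 1 t1.
  + by move=> u; rewrite in_itv/= => /andP[at_ _]; apply: p; lra.
  + by apply: is_derive_within_continuous => u ?; apply: p; lra.
  rewrite in_itv/= => /andP[tc c1]; rewrite qgap1 sub0r => E.
  rewrite -oppr_lt0 E nmulr_rlt0 ?subr_gt0// nmulr_llt0 ?subr_lt0//.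
  by rewrite powR_gt0//; lra.
- have [| |c] := @MVT _ (qgap g) (fun t => t `^ (g - 1 - 1) * (t - 1)) 1 t t1.
  + by move=> u; rewrite in_itv/= => /andP[at_ _]; apply: p; lra.
  + by apply: is_derive_within_continuous => u ?; apply: p; lra.
  rewrite in_itv/= => /andP[tc c1]; rewrite qgap1 subr0 => ->.
  by rewrite !mulr_gt0 ?subr_gt0// powR_gt0//; lra.
Qed.

(** The Bregman divergence [phi a - phi b - phi' b (a - b)], simplified by means of
[phi t = t qlog (g - 1) t - qlog g t]. *)
Definition qbregman g a b : R :=
  a * (qlog (g - 1) a - qlog (g - 1) b) - (qlog g a - qlog g b).

(** By homogeneity the divergence only depends on the quotient of its arguments,
up to a power: this turns a lower bound that is uniform in the parameter into
the positivity of [qgap] at two points. *)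
Lemma qbregmanE g a t : 0 < a -> 0 < t -> qbregman g a (a * t) = a `^ g * qgap g t.
Proof.
move=> a0 t0; rewrite /qbregman !qlogM// /qgap -(mul_powRB1 g a0).
ring.
Qed.

Lemma qbregman_ge0 g a b : 0 < a -> 0 < b -> 0 <= qbregman g a b.
Proof.
move=> a0 b0; rewrite -(divfK (lt0r_neq0 a0) b) mulrC qbregmanE ?divr_gt0//.
by rewrite mulr_ge0 ?powR_ge0 ?qgap_ge0 ?divr_gt0.
Qed.

Lemma cressie_readE g t : g != 0 -> 0 < t ->
  cressie_read g t = t * qlog (g - 1) t - qlog g t.
Proof.
move=> g0 t0; rewrite /cressie_read /qlog (negbTE g0) subr_eq0.
case: eqVneq => [->|g1].
  by rewrite powRr1 ?ltW// divr1; ring.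
rewrite mulrBl mul1r -(mul_powRB1 g t0); field.
by rewrite g0 subr_eq0 g1.
Qed.

Lemma derive1_cressie_read g t : g != 0 -> 0 < t ->
  derive1 (cressie_read g) t = qlog (g - 1) t.
Proof.
move=> g0 t0; rewrite derive1E.
have H1 := is_derive_qlog g t0.
have H2 := is_derive_qlog (g - 1) t0.
have H : is_derive t 1 (id * qlog (g - 1) - qlog g) (qlog (g - 1) t).
  apply: is_derive_eq.
  rewrite /GRing.scale/= mulr1.
  rewrite -(mul_powRB1 (g - 1) t0); ring.
have /@derive_val// : is_derive t 1 (cressie_read g) (qlog (g - 1) t).
apply: near_eq_is_derive H; near=> u.
by rewrite cressie_readE//; near: u; exact: lt_nbhsr.
Unshelve. all: by end_near. Qed.

End qlog.

(** * Integrals against densities and against contaminated laws *)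

Section density.
Context {R : realType}.
Local Notation mu := (@lebesgue_measure R).
Implicit Types (P Q : probability (measurableTypeR R) R) (f g h : R -> R).

Lemma has_density_dominates P f :
  measurable_fun setT f -> has_density P f -> P `<< mu.
Proof.
move=> mf Pf; apply/null_content_dominatesP => A mA A0.
rewrite Pf//; apply: null_set_integral => //.
exact/measurable_EFinP/measurable_funTS.
Qed.

(** A density is almost everywhere the Radon-Nikodym derivative, since both have
the same integral over every measurable set. *)
Lemma ge0_integral_density P f (h : R -> \bar R) :
  measurable_fun setT f -> (forall x, 0 <= f x) -> has_density P f ->
  measurable_fun setT h -> (forall x, (0 <= h x)%E) ->
  (\int[P]_x h x = \int[mu]_x (h x * (f x)%:E))%E.
Proof.
move=> mf f0 Pf mh h0.
have dom := has_density_dominates mf Pf.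
rewrite -(Radon_Nikodym_SigmaFinite.change_of_variables dom h0)//.
have Fi := Radon_Nikodym_SigmaFinite.f_integrable dom.
apply: ae_eq_integral => //.
- apply: emeasurable_funM => //; exact: measurable_int Fi.
- by apply: emeasurable_funM => //; exact/measurable_EFinP.
- apply: ae_eqe_mul2l; apply: integral_ae_eq => //.
  + exact/measurable_EFinP.
  + move=> E _ mE; rewrite -Radon_Nikodym_SigmaFinite.f_integral//.
    exact: Pf.
Qed.

Lemma ge0_integral_change_density P Q f g (h : R -> \bar R) :
  measurable_fun setT f -> (forall x, 0 <= f x) -> has_density P f ->
  measurable_fun setT g -> (forall x, 0 < g x) -> has_density Q g ->
  measurable_fun setT (fun x => f x / g x) ->
  measurable_fun setT h -> (forall x, (0 <= h x)%E) ->
  (\int[P]_x h x = \int[Q]_x (h x * (f x / g x)%:E))%E.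
Proof.
move=> mf f0 Pf mg g0 Qg mfg mh h0.
rewrite (ge0_integral_density mf f0 Pf)// (ge0_integral_density mg _ Qg)//.
- apply: eq_integral => x _; rewrite -muleA -EFinM divfK//.
  by rewrite gt_eqF.
- by move=> x; exact: ltW.
- by apply: emeasurable_funM => //; exact/measurable_EFinP.
- by move=> x; rewrite mule_ge0// lee_fin divr_ge0// ltW.
Qed.

(** The positive factor [f / g] commutes with the positive and negative parts, so
the identity for nonnegative functions extends to all measurable ones, whether
integrable or not. *)
Lemma integral_change_density P Q f g (h : R -> R) :
  measurable_fun setT f -> (forall x, 0 < f x) -> has_density P f ->
  measurable_fun setT g -> (forall x, 0 < g x) -> has_density Q g ->
  measurable_fun setT (fun x => f x / g x) ->
  measurable_fun setT h ->
  (\int[P]_x (h x)%:E = \int[Q]_x (f x / g x * h x)%:E)%E.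
Proof.
move=> mf f0 Pf mg g0 Qg mfg mh.
have f0' x : 0 <= f x by exact: ltW.
rewrite integralE [RHS]integralE; congr (_ - _)%E.
- rewrite (ge0_integral_change_density mf f0' Pf mg g0 Qg mfg)//.
  + apply: eq_integral => x _; rewrite !funeposE/= -!EFin_max -EFinM.
    by rewrite maxr_pMl ?mul0r ?[h x * _]mulrC// divr_ge0// ltW.
  + exact/measurable_funepos/measurable_EFinP.
- rewrite (ge0_integral_change_density mf f0' Pf mg g0 Qg mfg)//.
  + apply: eq_integral => x _; rewrite !funenegE/= -!EFin_max -EFinM.
    by rewrite maxr_pMl ?mul0r ?mulNr ?[h x * _]mulrC// divr_ge0// ltW.
  + exact/measurable_funeneg/measurable_EFinP.
Qed.

Lemma integrable_change_density P Q f g h :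
  measurable_fun setT f -> (forall x, 0 < f x) -> has_density P f ->
  measurable_fun setT g -> (forall x, 0 < g x) -> has_density Q g ->
  measurable_fun setT (fun x => f x / g x) ->
  P.-integrable setT (EFin \o h) ->
  Q.-integrable setT (EFin \o (fun x => f x / g x * h x)).
Proof.
move=> mf f0 Pf mg g0 Qg mfg /integrableP[/measurable_EFinP mh hoo].
apply/integrableP; split.
  by apply/measurable_EFinP; exact: measurable_funM.
move: hoo; rewrite (ge0_integral_change_density mf _ Pf mg g0 Qg mfg)//.
- apply: le_lt_trans; rewrite le_eqVlt; apply/orP; left; apply/eqP.
  apply: eq_integral => x _ /=; rewrite normrM EFinM muleC; congr (_ * _%:E)%E.
  by rewrite ger0_norm// divr_ge0// ltW.
- by move=> x; exact: ltW.
- by apply: measurableT_comp => //; exact/measurable_EFinP.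
Qed.

End density.

Section contaminate.
Context {R : realType}.
Implicit Types (P : probability (measurableTypeR R) R) (h : R -> R).

Lemma ge0_integral_contaminate P (x e : R) (h : R -> \bar R) : 0 < e < 1 ->
  measurable_fun setT h -> (forall y, (0 <= h y)%E) ->
  (\int[contaminate P x e]_y h y = (1 - e)%:E * \int[P]_y h y + e%:E * h x)%E.
Proof.
move=> /andP[e0 e1] mh h0.
have cE : (clip01 e)%:num = e.
  by rewrite /= ger0_norm ?ltW// min_l// ltW.
rewrite /contaminate /mixture [LHS]ge0_integral_measure_add//.
rewrite ge0_integral_mscale// ge0_integral_mscale//=.
by rewrite integral_dirac// diracT mul1e -[Num.min _ _]/((clip01 e)%:num) cE.
Qed.

Lemma integral_contaminate P (x e : R) (h : R -> R) : 0 < e < 1 ->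
  P.-integrable setT (EFin \o h) ->
  (\int[contaminate P x e]_y (h y)%:E =
   ((1 - e) * Rintegral P setT h + e * h x)%:E)%E.
Proof.
move=> e01 ih.
have mh := measurable_int _ ih.
have ip := integrable_funepos measurableT ih.
have im := integrable_funeneg measurableT ih.
rewrite integralE ge0_integral_contaminate//; last exact: measurable_funepos.
rewrite ge0_integral_contaminate//; last exact: measurable_funeneg.
rewrite /Rintegral integralE.
have fp := integrable_fin_num measurableT ip.
have fm := integrable_fin_num measurableT im.
rewrite -(fineK fp) -(fineK fm) !funeposE !funenegE/= -!EFin_max.
rewrite -?EFinM -?EFinD -?EFinN -?EFinD; congr (_%:E).
have E : h x = Num.max (h x) 0 - Num.max (- h x) 0.
  by rewrite /Num.max; case: ltP => ?; case: ltP => ?; lra.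
rewrite [in RHS]E; ring.
Qed.

(** When the integrand is bounded above by an integrable function, its positive
part is integrable, so failure of integrability can only mean the value -oo, and
no contamination repairs this. *)
Lemma integral_contaminate_Ny P (x e : R) (h u : R -> R) : 0 < e < 1 ->
  measurable_fun setT h -> P.-integrable setT (EFin \o u) ->
  (forall y, h y <= u y) ->
  ~ P.-integrable setT (EFin \o h) ->
  (\int[contaminate P x e]_y (h y)%:E = -oo)%E.
Proof.
move=> /andP[e0 e1] mh iu hu nih.
have mh' : measurable_fun setT (EFin \o h) by exact/measurable_EFinP.
have ip : P.-integrable setT ((EFin \o h)^\+)%E.
  apply: le_integrable (integrable_funepos measurableT iu) => //.
    exact: measurable_funepos.
  move=> y _; rewrite !gee0_abs// !funeposE/= -!EFin_max lee_fin.
  by rewrite ge_max !le_max hu lexx orbT.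
have E : (\int[P]_y ((EFin \o h)^\- y) = +oo)%E.
  apply/eqP/negPn/negP => N; apply: nih.
  have im : P.-integrable setT ((EFin \o h)^\-)%E.
    apply/integrableP; split; first exact: measurable_funeneg.
    under eq_integral do rewrite gee0_abs//.
    by rewrite ltey.
  rewrite (funeposneg (EFin \o h)); exact: integrableB.
rewrite integralE !ge0_integral_contaminate ?e0//; last first.
- exact: measurable_funepos.
- exact: measurable_funeneg.
rewrite E gt0_muley ?lte_fin ?subr_gt0//.
have fp := integrable_fin_num measurableT ip.
by rewrite -(fineK fp) !funeposE !funenegE/= -!EFin_max.
Qed.

End contaminate.

(** * Influence functions of argsup functionals *)

Section parameter_derivative.
Context {R : realType} d {T : measurableType d}.

(** The derivative is the limit of the difference quotients along the sequence
[c / n.+1], whose evaluation points stay in [[t, t + c]]. *)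
Lemma measurable_derive1_param (f : R -> T -> R) (t c : R) : 0 < c ->
  (forall s, t <= s <= t + c -> measurable_fun setT (f s)) ->
  (forall y, derivable (f ^~ y) t 1) ->
  measurable_fun setT (fun y => derive1 (f ^~ y) t).
Proof.
move=> c0 mf df; apply/measurable_EFinP.
pose h (n : nat) : R := c / n.+1%:R.
have h_gt0 n : 0 < h n by rewrite divr_gt0.
have h_le n : h n <= c by rewrite ler_pdivrMr// ler_peMr ?ler1n// ltW.
have h_cvg : h n @[n --> \oo] --> 0.
  by rewrite -[X in _ --> X](mulr0 c); apply: cvgMr; exact: cvg_harmonic.
apply: (@emeasurable_fun_cvg _ _ _ _
  (fun n y => ((h n)^-1 * (f (h n + t) y - f t y))%:E)).
- move=> n; apply/measurable_EFinP; apply: measurable_funM => //.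
  apply: measurable_funB; apply: mf.
    by rewrite [h n + t]addrC lerDl lerD2l h_le ltW.
  by rewrite lexx/= lerDl ltW.
- move=> y _; apply: cvg_EFin; first exact: nearW.
  have /cvg_ex[/= l Hl] := df y.
  have dl : derive1 (f ^~ y) t = l.
    by apply/cvg_lim => //; move: Hl; under eq_fun do rewrite scaler1.
  rewrite /= dl.
  move/cvgr_dnbhsP : Hl => /(_ h).
  have hh : (forall n, h n != 0) /\ h n @[n --> \oo] --> 0.
    by split => // n; rewrite gt_eqF.
  move=> /(_ hh).
  by under eq_fun do rewrite scaler1.
Qed.

End parameter_derivative.

Section mfunctional.
Context {R : realType}.
Variables (Theta : set R) (P0 : probability (measurableTypeR R) R)
  (theta0 alpha : R) (m : R -> R -> R -> R)
  (T : probability (measurableTypeR R) R -> R).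
Hypothesis theta0T : Theta° theta0.
Hypothesis m_measurable : forall t, Theta t -> measurable_fun setT (m t alpha).
Hypothesis m_integrable : P0.-integrable setT (EFin \o m theta0 alpha).
Hypothesis theta0_argsup :
  is_unique_argsup Theta (dual_criterion m alpha P0) theta0.
Hypothesis m_reg : m_regular Theta P0 theta0 (fun t x => m t alpha x).
Hypothesis far_lt : forall x eta : R, 0 < eta -> exists2 e0 : R, 0 < e0 &
  forall e t : R, 0 < e -> e < e0 -> Theta t -> eta <= `|t - theta0| ->
  (dual_criterion m alpha (contaminate P0 x e) t <
   dual_criterion m alpha (contaminate P0 x e) theta0)%E.
Hypothesis T_argsup : is_dual_functional Theta m alpha T.

Let m' t x := derive1 (fun s => m s alpha x) t.
Let m'' t x := derive1n 2 (fun s => m s alpha x) t.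
Let M t := Rintegral P0 setT (m t alpha).
Let N t := Rintegral P0 setT (m' t).

Local Lemma functional_at_model : T P0 = theta0.
Proof.
case: theta0_argsup => h0 huniq; apply: huniq.
by apply: T_argsup; exists theta0.
Qed.

Let regular_radius (rho : R) (G : R -> R) :=
  [/\ 0 < rho, P0.-integrable setT (EFin \o G) &
   forall t, `|t - theta0| < rho ->
   [/\ Theta t, (forall x, derivable (fun s => m s alpha x) t 1),
       (forall x, derivable (fun s => m' s x) t 1),
       (forall x, `|m' t x| <= G x) & (forall x, `|m'' t x| <= G x)]].

(** One radius and one dominating function serve both derivatives. *)
Local Lemma regular_nbhs : exists rho G, regular_radius rho G.
Proof.
case: m_reg => mC2 _ _ [G1 [iG1 dG1]] [G2 [iG2 dG2]].
have : \forall t \near theta0, [/\ Theta° t, (forall x, `|m' t x| <= G1 x) &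
    (forall x, `|m'' t x| <= G2 x)].
  near=> t; split; last 2 first.
  - by near: t.
  - by near: t.
  - by near: t; apply: open_nbhs_nbhs; split => //; exact: open_interior.
move=> /nbhs_ballP[rho /= rho0 H].
exists rho, (fun x => `|G1 x| + `|G2 x|); split => //.
  have -> : (EFin \o (fun x => `|G1 x| + `|G2 x|)) =
    ((fun x => `|(EFin \o G1) x|) \+ (fun x => `|(EFin \o G2) x|))%E by [].
  by apply: integrableD => //; exact: integrable_abse.
move=> t trho; have [|Tt h1 h2] := H t; first by rewrite /ball/= distrC.
split => //.
- exact: interior_subset Tt.
- move=> x; have [h _ _] := mC2 x t Tt; exact: h.
- move=> x; have [_ h _] := mC2 x t Tt; exact: h.
- move=> x; apply: (le_trans (h1 x)); apply: (le_trans (ler_norm _)).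
  by rewrite lerDl.
- move=> x; apply: (le_trans (h2 x)); apply: (le_trans (ler_norm _)).
  by rewrite lerDr.
Unshelve. all: by end_near. Qed.

Section local.
Variables (rho : R) (G : R -> R).
Hypothesis regG : regular_radius rho G.

Let I := `]theta0 - rho, theta0 + rho[%classic.

Let inI t : I t <-> `|t - theta0| < rho.
Proof. by rewrite /I/= in_itv/= ltr_distl. Qed.

Let G0 x : 0 <= G x.
Proof.
case: regG => rho0 _ /(_ theta0) [|_ _ _ h _].
  by rewrite subrr normr0.
exact: le_trans (h x).
Qed.

(** Mean value inequality in the parameter, starting from [theta0]. *)
Local Lemma m_int t : I t -> P0.-integrable setT (EFin \o m t alpha).
Proof.
move=> It; case: regG => rho0 iG H.
have [Tt dm _ _ _] := H t (proj1 (inI t) It).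
apply: (@le_integrable _ _ _ P0 _ _ _
  (fun x => `|(m theta0 alpha x)%:E| + (rho%:E * (G x)%:E))%E) => //.
- by apply/measurable_EFinP; exact: m_measurable.
- move=> x _; rewrite /= -?EFinM -?EFinD lee_fin [leRHS]ger0_norm; last first.
    by rewrite addr_ge0 ?mulr_ge0 ?(ltW rho0).
  rewrite -lerBlDl; apply: (le_trans (lerB_dist _ _)).
  have dmv s : `|s - theta0| < rho -> is_derive s 1 (fun u => m u alpha x) (m' s x).
    move=> sr; have [_ d _ _ _] := H s sr.
    by rewrite /m' derive1E; exact/derivableP/d.
  have tr := proj1 (inI t) It.
  have step a b : a <= b -> (forall s, a <= s <= b -> `|s - theta0| < rho) ->
      b - a <= rho -> `|m b alpha x - m a alpha x| <= rho * G x.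
    move=> ab sab bar.
    have [| |c] := @MVT_segment _ (fun u => m u alpha x) (m' ^~ x) a b ab.
    + by move=> s; rewrite in_itv/= => /andP[a1 b1]; apply/dmv/sab; rewrite !ltW.
    + apply: derivable_within_continuous => s; rewrite in_itv/= => sab'.
      by case: (dmv s (sab s sab')).
    rewrite in_itv/= => cab ->; rewrite normrM mulrC ler_pM//.
      by rewrite ger0_norm ?subr_ge0.
    by have [_ _ _ hG _] := H c (sab c cab); exact: hG.
  move: tr; rewrite ltr_distl => /andP[t1 t2].
  have [t0|t0] := leP theta0 t.
    by apply: step => // [s /andP[s1 s2]|]; rewrite ?ltr_distl; lra.
  rewrite distrC; apply: step => // [|s /andP[s1 s2]|]; rewrite ?ltr_distl; lra.
- apply: integrableD => //; first exact: integrable_abse.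
  exact: integrableZl.
Qed.

Local Lemma m'_int t : I t -> P0.-integrable setT (EFin \o m' t).
Proof.
move=> It; case: regG => rho0 iG H.
have [Tt dm _ hG _] := H t (proj1 (inI t) It).
apply: le_integrable iG => //; last first.
  by move=> x _ /=; rewrite lee_fin [leRHS]ger0_norm.
apply/measurable_EFinP.
have [t1 t2] : theta0 - rho < t /\ t < theta0 + rho.
  by move: It; rewrite /I/= in_itv/= => /andP[].
apply: (@measurable_derive1_param _ _ _ (fun s => m s alpha) t
  ((theta0 + rho - t) / 2)) => //; first lra.
move=> s /andP[s1 s2]; apply: m_measurable.
have [|Ts _ _ _ _ //] := H s.
by rewrite ltr_distl; apply/andP; split; lra.
Qed.

Local Lemma is_derive_M t : I t -> is_derive t 1 M (N t).
Proof.
move=> It; case: regG => rho0 iG H.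
have Hd : forall s x, I s -> setT x -> derivable (fun u => m u alpha x) s 1.
  by move=> s x /inI /H[].
have Hb : forall s x, I s -> setT x -> `|partial1of2 (fun u => m u alpha) s x| <= G x.
  by move=> s x /inI /H[].
apply: DeriveDef.
  exact: (derivable_under_integral measurableT It m_int Hd G0 iG Hb).
rewrite -derive1E.
exact: (differentiation_under_integral measurableT It m_int Hd G0 iG Hb).
Qed.

Local Lemma is_derive_N : is_derive theta0 1 N (Rintegral P0 setT (m'' theta0)).
Proof.
case: regG => rho0 iG H.
have It : I theta0 by apply/inI; rewrite subrr normr0.
have Hd : forall s x, I s -> setT x -> derivable (fun u => m' u x) s 1.
  by move=> s x /inI /H[].
have Hb : forall s x, I s -> setT x -> `|partial1of2 m' s x| <= G x.
  by move=> s x /inI /H[].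
apply: DeriveDef.
  exact: (derivable_under_integral measurableT It m'_int Hd G0 iG Hb).
rewrite -derive1E.
exact: (differentiation_under_integral measurableT It m'_int Hd G0 iG Hb).
Qed.

Local Lemma crit_contaminate x e t : 0 < e < 1 -> I t ->
  dual_criterion m alpha (contaminate P0 x e) t =
  ((1 - e) * M t + e * m t alpha x)%:E.
Proof. by move=> e01 It; rewrite /dual_criterion integral_contaminate//; exact: m_int. Qed.

Local Lemma is_derive_Me x e t : I t ->
  is_derive t 1 (fun t => (1 - e) * M t + e * m t alpha x) ((1 - e) * N t + e * m' t x).
Proof.
move=> It; have H1 := is_derive_M It.
have H2 : is_derive t 1 (fun u => m u alpha x) (m' t x).
  case: regG => rho0 iG H; have [_ d _ _ _] := H _ (proj1 (inI t) It).
  by rewrite /m' derive1E; exact/derivableP/d.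
have -> : (fun t => (1 - e) * M t + e * m t alpha x) =
  (1 - e) *: M + e *: (fun u => m u alpha x) by [].
exact: is_deriveD (is_deriveZ (1 - e) H1) (is_deriveZ e H2).
Qed.

Local Lemma derivative_at_theta0 : N theta0 = 0.
Proof.
have [rho0 _ H] := regG.
have It : I theta0 by apply/inI; rewrite subrr normr0.
have h := @derive1_at_max _ M (theta0 - rho) (theta0 + rho) theta0.
have /@derive_val <- : is_derive theta0 1 M 0.
  apply: h => //; first lra.
    by move=> t It'; case: (is_derive_M It').
  move=> t It'; case: theta0_argsup => -[_ +] _ => /(_ t).
  have [Tt _ _ _ _] := H t (proj1 (inI t) It').
  move=> /(_ Tt); rewrite /dual_criterion /M /Rintegral => h'.
  apply: fine_le => //; apply: integrable_fin_num => //; exact: m_int.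
by have /@derive_val -> := is_derive_M It.
Qed.

(** The contaminated criterion is continuous on the segment of radius [eta]
around [theta0], hence has a maximum there, which is global because the
criterion is smaller than its value at [theta0] outside the segment. So the
contaminated argsup exists, lies within [eta] of [theta0], and is an interior
critical point. *)
Local Lemma functional_localized x eta : 0 < eta -> eta < rho ->
  exists2 e0, 0 < e0 & forall e, 0 < e -> e < e0 ->
  `|T (contaminate P0 x e) - theta0| < eta /\
  (1 - e) * N (T (contaminate P0 x e)) + e * m' (T (contaminate P0 x e)) x = 0.
Proof.
move=> eta0 etar; have [rho0 _ H] := regG.
have [e1 e10 far] := far_lt x eta0.
exists (Num.min e1 1); first by rewrite lt_min e10 ltr01.
move=> e e0; rewrite lt_min => /andP[ee1 e_1].
have e01 : 0 < e < 1 by rewrite e0.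
have sub t : `|t - theta0| <= eta -> I t.
  by move=> h; apply/inI; exact: le_lt_trans etar.
have [||c cK cmax] := @EVT_max _ (fun t => (1 - e) * M t + e * m t alpha x)
  (theta0 - eta) (theta0 + eta).
- lra.
- apply: derivable_within_continuous => t; rewrite in_itv/= => tK.
  have It : I t by apply: sub; rewrite ler_distl.
  by case: (is_derive_Me x e It).
have Ic : I c by apply: sub; rewrite ler_distl; move: cK; rewrite in_itv.
have [Tc _ _ _ _] := H c (proj1 (inI c) Ic).
have It0 : I theta0 by apply: sub; rewrite subrr normr0 ltW.
have ex : exists t, is_argsup Theta (dual_criterion m alpha (contaminate P0 x e)) t.
  exists c; split => // s Ts.
  have [sfar|snear] := leP eta `|s - theta0|.
    apply: (le_trans (ltW (far e s e0 ee1 Ts sfar))).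
    rewrite !crit_contaminate// lee_fin; apply: cmax.
    by rewrite in_itv/=; lra.
  have Is : I s by apply/sub/ltW.
  rewrite !crit_contaminate// lee_fin; apply: cmax.
  by rewrite in_itv/= -ler_distl ltW.
have [TT Tmax] := T_argsup ex.
set s := T (contaminate P0 x e) in TT Tmax *.
have Tth0 : Theta theta0 by apply: interior_subset.
have snear : `|s - theta0| < eta.
  rewrite ltNge; apply/negP => /(far e s e0 ee1 TT).
  by rewrite ltNge Tmax.
split => //.
have Is : I s by apply/sub/ltW.
have h := @derive1_at_max _ (fun t => (1 - e) * M t + e * m t alpha x)
   (theta0 - rho) (theta0 + rho) s.
have := is_derive_Me x e Is => /@derive_val <-.
have /@derive_val <-// : is_derive s 1 (fun t => (1 - e) * M t + e * m t alpha x) 0.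
apply: h; [lra| |exact: Is|].
  by move=> t It'; case: (is_derive_Me x e It').
move=> t It'; have [Tt _ _ _ _] := H t (proj1 (inI t) It').
have := Tmax t Tt; rewrite !crit_contaminate//.
Qed.

End local.

(** With [N] the derivative of the uncontaminated criterion and [t e] the value of
the functional, the critical point equation reads
[(1 - e) N (t e) + e m'(t e, x) = 0]. As [N theta0 = 0], Caratheodory's form
[N t = g t (t - theta0)] of differentiability at [theta0] gives
[(t e - theta0) / e = - m'(t e, x) / ((1 - e) g (t e))], and [t e] tends to
[theta0]. *)
Lemma cvg_if_quotient x : if_quotient T P0 x e @[e --> 0^'+] -->
  - derive1 (fun t => m t alpha x) theta0 /
    Rintegral P0 setT (fun y => derive1n 2 (fun t => m t alpha y) theta0).
Proof.
have [rho [G gG]] := regular_nbhs.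
have [rho0 _ H] := gG.
case: m_reg => mC2 _ h0 _ _.
set h := Rintegral _ _ _ in h0 *.
have dN : is_derive theta0 1 N h := is_derive_N gG.
have /is_derive1_caratheodory[g [gE cg gh]] := dN.
pose t e := T (contaminate P0 x e).
have tcvg : t e @[e --> 0^'+] --> theta0.
  apply/cvgrPdist_lt => eps eps0.
  have eta0 : 0 < Num.min eps (rho / 2) by rewrite lt_min eps0; lra.
  have eta_rho : Num.min eps (rho / 2) < rho.
    by rewrite gt_min; apply/orP; right; lra.
  have [e0 e00 he] := functional_localized gG x eta0 eta_rho.
  near=> e.
  have [||+ _] := he e.
  - by near: e; exact: nbhs_right_gt.
  - by near: e; exact: nbhs_right_lt.
  by rewrite lt_min distrC => /andP[].
have foc : \forall e \near 0^'+, (1 - e) * N (t e) + e * m' (t e) x = 0.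
  have eta0 : 0 < rho / 2 by lra.
  have eta_rho : rho / 2 < rho by lra.
  have [e0 e00 he] := functional_localized gG x eta0 eta_rho.
  near=> e.
  have [||_ ->//] := he e.
  - by near: e; exact: nbhs_right_gt.
  - by near: e; exact: nbhs_right_lt.
have cm' : {for theta0, continuous (m' ^~ x)}.
  have [|_ _ d _ _] := H theta0; first by rewrite subrr normr0.
  exact/differentiable_continuous/derivable1_diffP/d.
have c1 : m' (t e) x @[e --> 0^'+] --> m' theta0 x by exact: cvg_comp tcvg cm'.
have c2 : g (t e) @[e --> 0^'+] --> h by rewrite -gh; exact: cvg_comp tcvg cg.
have cid : e @[e --> (0:R)^'+] --> (0:R) by exact: cvg_at_right_filter.
have c3 : (1 - e) * g (t e) @[e --> (0:R)^'+] --> h.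
  rewrite -[X in _ --> X]mul1r; apply: cvgM => //.
  rewrite -[X in _ --> X]subr0; apply: cvgB => //; exact: cvg_cst.
have gn0 : \forall e \near (0:R)^'+, g (t e) != 0.
  exact: (cvgr_neq0 _ c2 h0).
suff : - m' (t e) x / ((1 - e) * g (t e)) @[e --> (0:R)^'+] --> - m' theta0 x / h.
  apply: cvg_trans; apply: near_eq_cvg; near=> e.
  have e0 : 0 < e by near: e; exact: nbhs_right_gt.
  have e1 : e < 1 by near: e; exact: nbhs_right_lt.
  have gt : g (t e) != 0 by near: e.
  have F : (1 - e) * N (t e) + e * m' (t e) x = 0 by near: e.
  rewrite /if_quotient functional_at_model -/(t e).
  have E := gE (t e); rewrite (derivative_at_theta0 gG) subr0 in E.
  rewrite E in F.
  have -> : m' (t e) x = - ((1 - e) * (g (t e) * (t e - theta0))) / e.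
    apply/eqP; rewrite -[eqbLHS](mulfK (lt0r_neq0 e0)); apply/eqP.
    by congr (_ / _); lra.
  by field; rewrite gt subr_eq0 gt_eqF// gt_eqF.
apply: cvgM; first exact: cvgN.
exact: cvgV.
Unshelve. all: by end_near. Qed.

End mfunctional.

(** * Decay of the density *)

Section smooth_density_tail.
Context {R : realType}.
Local Notation mu := (@lebesgue_measure R).
Variable p : R -> R.
Implicit Types a b s t u v eps : R.
Hypothesis p_gt0 : forall x, 0 < p x.
Hypothesis p_derivable : forall x, derivable p x 1.
Hypothesis p_int1 : (\int[mu]_x (p x)%:E = 1)%E.
Hypothesis up_int : (\int[mu]_u `|u * derive1 p u|%:E < +oo)%E.
Hypothesis dp_cont : forall u : R, u != 0 -> {for u, continuous (derive1 p)}.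

Let h u := p u + `|u * derive1 p u|.
Let mass a b := Rintegral mu `[a, b] h.

Let p_cont : continuous p.
Proof. by move=> x; exact/differentiable_continuous/derivable1_diffP. Qed.

Local Lemma measurable_dp : measurable_fun setT (derive1 p).
Proof.
have -> : derive1 p = fun y => derive1 (fun s => (p \o shift y) s) 0.
  apply/funext => y; rewrite [RHS](@derive1_comp _ (shift y) p 0)//.
  rewrite /= add0r [X in _ = _ * X]derive1E.
  have /@derive_val -> := is_derive_shift 0 1 y.
  by rewrite mulr1.
apply: (@measurable_derive1_param _ _ _ (fun s y => p (s + y)) 0 1).
- exact: ltr01.
- move=> s _; apply: continuous_measurable_fun => y.
  apply: (@continuous_comp _ _ _ (fun y => s + y) p); last exact: p_cont.
  by apply: cvgD; [exact: cvg_cst|exact: cvg_id].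
- move=> y; apply/derivable1_diffP/differentiable_comp => //.
  exact/derivable1_diffP/p_derivable.
Qed.

Local Lemma h_ge0 u : 0 <= h u.
Proof. by rewrite addr_ge0// ltW. Qed.

Local Lemma p_integrable : mu.-integrable setT (EFin \o p).
Proof.
apply/integrableP; split.
  by apply/measurable_EFinP; exact: continuous_measurable_fun.
under eq_integral do rewrite /= ger0_norm ?ltW//.
by rewrite p_int1 ltry.
Qed.

Local Lemma h_integrable : mu.-integrable setT (EFin \o h).
Proof.
have -> : EFin \o h =
    ((EFin \o p) \+ (EFin \o (fun u : R => `|u * derive1 p u|%R)))%E by [].
apply: integrableD => //; first exact: p_integrable.
apply/integrableP; split.
  apply/measurable_EFinP/measurableT_comp => //.
  by apply: measurable_funM => //; exact: measurable_dp.
by under eq_integral do rewrite /= normr_id.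
Qed.

Let hS (A : set R) : measurable A -> mu.-integrable A (EFin \o h).
Proof. by move=> mA; apply: integrableS h_integrable. Qed.

Local Lemma mass_le (A B : set R) : measurable A -> measurable B ->
  A `<=` B -> Rintegral mu A h <= Rintegral mu B h.
Proof.
move=> mA mB AB; rewrite fine_le ?integrable_fin_num ?hS//.
apply: ge0_subset_integral => //.
- exact: measurable_int (hS mB).
- by move=> x _; rewrite lee_fin h_ge0.
Qed.

(** Take the minimum of [p] on the segment. *)
Local Lemma p_le_mass a b : a < b ->
  exists2 v, a <= v <= b & (b - a) * p v <= mass a b.
Proof.
move=> ab; have [||v vab vmin] := @EVT_min _ p a b.
- exact: ltW.
- by apply: continuous_subspaceT => x; exact: p_cont.
exists v => //.
have -> : (b - a) * p v = Rintegral mu `[a, b] (cst (p v)).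
  rewrite Rintegral_cst//= lebesgue_measure_itv/= lte_fin ab.
  by rewrite -EFinD/= mulrC.
apply: le_Rintegral => //; last 2 first.
- exact: hS.
- move=> x; rewrite /= => xab; apply: (le_trans (vmin x xab)).
  by rewrite lerDl.
apply: (@le_integrable _ _ _ mu _ _ _ (EFin \o h)) => //; last exact: hS.
  by apply/measurable_EFinP; exact: measurable_cst.
move=> x; rewrite /= => xab; rewrite lee_fin !ger0_norm ?h_ge0 ?(ltW (p_gt0 v))//.
by apply: (le_trans (vmin x xab)); rewrite lerDl.
Qed.

(** The function [u p u] has derivative [p u + u p' u], which is dominated by [h]
and continuous away from 0, so the fundamental theorem of calculus applies. *)
Local Lemma scaled_diff a b s t : (0 < a) || (b < 0) ->
  a <= s <= b -> a <= t <= b -> `|t * p t - s * p s| <= mass a b.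
Proof.
move=> ab0; wlog st : s t / s <= t.
  move=> H sab tab; have [|/ltW] := leP s t; first by move=> /H; exact.
  by move=> /H; rewrite distrC; exact.
move=> /andP[as_ sb] /andP[at_ tb].
have mass0 : 0 <= mass a b by apply: Rintegral_ge0 => x _; exact: h_ge0.
move: st; rewrite le_eqVlt => /predU1P[->|st]; first by rewrite subrr normr0.
pose F u := u * p u.
have dF u : is_derive u 1 F (p u + u * derive1 p u).
  have H : is_derive u 1 p (derive1 p u) by rewrite derive1E; exact/derivableP.
  have -> : F = id * p by [].
  apply: is_derive_eq; rewrite /GRing.scale/= mulr1; ring.
have cF : continuous F.
  move=> u; apply: differentiable_continuous; apply/derivable1_diffP.
  by case: (dF u).
have n0 u : s <= u <= t -> u != 0.
  move=> /andP[su ut]; case/orP: ab0 => [a0|b0].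
    by rewrite gt_eqF//; lra.
  by rewrite lt_eqF//; lra.
have cf u : u != 0 -> {for u, continuous (fun u => p u + u * derive1 p u)}.
  move=> u0; apply: cvgD; first exact: p_cont.
  by apply: cvgM; [exact: cvg_id|exact: dp_cont].
have FTC : (\int[mu]_(x in `[s, t]) (p x + x * derive1 p x)%:E = (F t)%:E - (F s)%:E)%E.
  apply: continuous_FTC2 => //.
  - apply/continuous_in_subspaceT => u; rewrite inE/= in_itv/= => /n0.
    exact: cf.
  - split.
    + by move=> u _; case: (dF u).
    + exact/cvg_at_right_filter/cF.
    + exact/cvg_at_left_filter/cF.
  - by move=> u _; rewrite derive1E; have /@derive_val -> := dF u.
have msub : `[s, t] `<=` (`[a, b] : set R).
  by apply: subset_itv; rewrite bnd_simp.
have gi : mu.-integrable `[s, t] (EFin \o (fun x => p x + x * derive1 p x)).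
  apply: (@le_integrable _ _ _ mu _ _ _ (EFin \o h)) => //; last exact: hS.
  - apply/measurable_EFinP/measurable_funTS/measurable_funD.
      exact: continuous_measurable_fun.
    by apply: measurable_funM => //; exact: measurable_dp.
  - move=> x _ /=; rewrite lee_fin [leRHS]ger0_norm ?h_ge0//.
    by rewrite (le_trans (ler_normD _ _))// lerD2r ger0_norm// ltW.
have -> : t * p t - s * p s = Rintegral mu `[s, t] (fun x => p x + x * derive1 p x).
  by rewrite /Rintegral FTC.
apply: le_trans (le_normr_Rintegral _ gi) _ => //.
apply: (@le_trans _ _ (mass s t)); last exact: mass_le.
apply: le_Rintegral => //; [exact: integrable_norm|exact: hS|].
move=> x _; rewrite (le_trans (ler_normD _ _))// lerD2r ger0_norm// ltW//.
Qed.

(** On [[u, 2 u]] the function [v p v] oscillates by at most the mass of [h], and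
somewhere on it [p v] is at most the mass divided by [u]. *)
Local Lemma scaled_le_pos u : 0 < u -> u * p u <= 3 * mass u (2 * u).
Proof.
move=> u0; have [|v /andP[uv vu] vm] := @p_le_mass u (2 * u); first lra.
have := @scaled_diff u (2 * u) v u; rewrite u0 uv vu/= lexx => /(_ isT isT).
have -> : (u <= 2 * u) by lra.
move=> /(_ isT); rewrite ler_norml => /andP[_ h1].
have h2 : v * p v <= 2 * u * p v by rewrite ler_wpM2r// ltW.
have -> : 3 * mass u (2 * u) = mass u (2 * u) + 2 * mass u (2 * u) by ring.
have h3 : u * p v <= mass u (2 * u) by move: vm; rewrite (_ : 2 * u - u = u)//; ring.
lra.
Qed.

Local Lemma scaled_le_neg u : u < 0 -> - u * p u <= 3 * mass (2 * u) u.
Proof.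
move=> u0; have [|v /andP[uv vu] vm] := @p_le_mass (2 * u) u; first lra.
have := @scaled_diff (2 * u) u u v; rewrite u0 uv vu/= lexx orbT => /(_ isT).
have -> : (2 * u <= u) by lra.
move=> /(_ isT isT); rewrite ler_norml => /andP[_ h1].
have h2 : (- v) * p v <= - (2 * u) * p v by rewrite ler_wpM2r ?lerN2// ltW.
have h3 : (- u) * p v <= mass (2 * u) u.
  by move: vm; rewrite (_ : u - 2 * u = - u)//; ring.
lra.
Qed.

(** By continuity on [[-1, 1]], and elsewhere because [`|u| * p u] is at most three
times the total mass of [h]. *)
Lemma density_bounded : exists B, forall u, p u <= B.
Proof.
have [||c cI cmax] := @EVT_max _ p (-1) 1; first lra.
  by apply: continuous_subspaceT => x; exact: p_cont.
pose H := Rintegral mu setT h.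
have H0 : 0 <= H by apply: Rintegral_ge0 => x _; exact: h_ge0.
exists (p c + 3 * H) => u.
have pc := p_gt0 c; have pu := p_gt0 u.
have [u1|u1] := leP `|u| 1.
  by rewrite (le_trans (cmax u _)) ?lerDl ?mulr_ge0// in_itv/= -ler_norml.
suff W : `|u| * p u <= 3 * H.
  have : p u <= `|u| * p u by rewrite ler_peMl// ltW.
  lra.
have [u0|u0] := leP 0 u.
  rewrite ger0_norm//; have u0' : 0 < u by move: u1; rewrite ger0_norm//; lra.
  apply: (le_trans (scaled_le_pos u0')); rewrite ler_pM2l//.
  exact: mass_le.
rewrite ltr0_norm//.
apply: (le_trans (scaled_le_neg u0)); rewrite ler_pM2l//.
exact: mass_le.
Qed.

(** The mass of [h] on [[u, 2 u]] is at most its mass beyond [u], which tends to 0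
by dominated convergence. *)
Lemma density_tail eps : 0 < eps ->
  exists2 N, 0 < N & forall u, N <= u -> u * p u <= eps.
Proof.
move=> eps0.
have : (fun n : nat => \int[mu]_x ((h \_ `[n%:R, +oo[) x)%:E)%E @ \oo -->
    (\int[mu]_x (cst 0%E x : \bar R))%E.
  apply: (@dominated_cvg _ _ _ mu _ measurableT _ _ (EFin \o h)) => //.
  - move=> n; apply/measurable_EFinP/(measurable_restrictT _ _).1 => //.
    apply/measurable_funTS/measurable_EFinP.
    exact: measurable_int h_integrable.
  - move=> x _; apply: cvg_near_cst; near=> n.
    rewrite patchE memNset//= in_itv/= andbT; apply/negP; rewrite -ltNge.
    near: n; exact: nbhs_infty_gtr.
  - exact: h_integrable.
  - move=> n x _ /=; rewrite lee_fin patchE; case: ifPn => _.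
      by rewrite ger0_norm ?h_ge0.
    by rewrite normr0 h_ge0.
rewrite integral0 => /fine_cvgP[_ /cvgrPdist_lt /(_ (eps / 3))].
rewrite divr_gt0// => /(_ isT)[n _ /(_ n (leqnn n))] /=.
rewrite sub0r normrN => /ltW hn.
exists n.+1%:R => // u nu; have u0 : 0 < u by exact: lt_le_trans nu.
apply: (le_trans (scaled_le_pos u0)).
suff : mass u (2 * u) <= eps / 3 by lra.
apply: le_trans hn; rewrite -/(Rintegral _ _ _) -Rintegral_mkcond.
apply: le_trans (ler_norm _); apply: mass_le => // x/=.
rewrite !in_itv/= andbT => /andP[ux _].
by rewrite (le_trans _ ux)// (le_trans _ nu)// ler_nat.
Unshelve. all: by end_near. Qed.

End smooth_density_tail.

(** * The density ratio in a scale model *)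

Section ratio.
Context {R : realType}.
Variable p : R -> R.
Hypothesis p_gt0 : forall x, 0 < p x.
Hypothesis p_derivable : forall x, derivable p x 1.
Variables (alpha gamma : R).
Hypothesis alpha_gt0 : 0 < alpha.
Hypothesis gamma_neq0 : gamma != 0.
Implicit Types t x s : R.

Let p_cont : continuous p.
Proof. by move=> x; exact/differentiable_continuous/derivable1_diffP. Qed.

Lemma scale_density_gt0 t x : 0 < t -> 0 < scale_density p t x.
Proof. by move=> t0; rewrite mulr_gt0 ?invr_gt0. Qed.

Lemma continuous_scale_density t : continuous (scale_density p t).
Proof.
move=> x; apply: cvgM; first exact: cvg_cst.
apply: (@continuous_comp _ _ _ ( *%R t^-1) p); last exact: p_cont.
by apply: cvgM; [exact: cvg_cst|exact: cvg_id].
Qed.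

Definition scale_ratio t x := scale_density p alpha x / scale_density p t x.

Lemma scale_ratio_gt0 t x : 0 < t -> 0 < scale_ratio t x.
Proof. by move=> t0; rewrite divr_gt0 ?scale_density_gt0. Qed.

Lemma continuous_scale_ratio t : 0 < t -> continuous (scale_ratio t).
Proof.
move=> t0 x; apply: cvgM; first exact: continuous_scale_density.
apply: cvgV; last exact: continuous_scale_density.
by rewrite gt_eqF// scale_density_gt0.
Qed.

Lemma continuous_qlog_scale_ratio s t : 0 < t ->
  continuous (fun x => qlog s (scale_ratio t x)).
Proof.
move=> t0 x; apply: (@continuous_comp _ _ _ (scale_ratio t) (qlog s)).
  exact: continuous_scale_ratio.
apply/differentiable_continuous/derivable1_diffP.
by have [] := is_derive_qlog s (scale_ratio_gt0 x t0).
Qed.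

Lemma dphi_ratioE t x : 0 < t ->
  dphi_ratio (cressie_read gamma) (scale_density p) t alpha x =
  qlog (gamma - 1) (scale_ratio t x).
Proof. by move=> t0; rewrite /dphi_ratio derive1_cressie_read// scale_ratio_gt0. Qed.

Lemma dual_mE (P : R -> probability (measurableTypeR R) R) t x : 0 < t ->
  dual_m (cressie_read gamma) (scale_density p) P t alpha x =
  Rintegral (P alpha) setT (fun y => qlog (gamma - 1) (scale_ratio t y))
  - qlog gamma (scale_ratio t x).
Proof.
move=> t0; rewrite /dual_m; congr (_ - _).
  by apply: eq_Rintegral => y _; exact: dphi_ratioE.
rewrite dphi_ratioE// cressie_readE ?scale_ratio_gt0// -/(scale_ratio t x).
rewrite mulrC; ring.
Qed.

(** The logarithmic derivative [u p' u / p u] at [u = x / t]; up to the factor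
[- t^-1] it is the derivative of [ln (p (x / t))] in [t]. *)
Definition scale_score t x : R := t^-1 * x * derive1 p (t^-1 * x) / p (t^-1 * x).

Local Lemma is_derive_p_scale t x : 0 < t ->
  is_derive t 1 (fun s => p (s^-1 * x)) (derive1 p (t^-1 * x) * (- t ^- 2 * x)).
Proof.
move=> t0.
have Hp : is_derive (t^-1 * x) 1 p (derive1 p (t^-1 * x)).
  by rewrite derive1E; exact/derivableP.
have Hi : is_derive t 1 (fun s => s^-1 * x) (- t ^- 2 * x).
  have Hv : is_derive t 1 (fun s : R => s^-1) (- t ^- 2 *: 1).
    by apply: is_deriveV; rewrite gt_eqF.
  have -> : (fun s => s^-1 * x) = x *: (fun s : R => s^-1).
    by apply/funext => s; rewrite mulrC.
  by apply: is_derive_eq; rewrite /GRing.scale/= mulr1 mulrC.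
exact: (@is_derive1_comp _ p (fun s => s^-1 * x)).
Qed.

Lemma is_derive_ln_p_scale t x : 0 < t ->
  is_derive t 1 (fun s => ln (p (s^-1 * x))) (- scale_score t x / t).
Proof.
move=> t0.
have H1 := is_derive_p_scale x t0.
have H2 := is_derive1_ln (p_gt0 (t^-1 * x)).
have H := @is_derive1_comp _ (@ln R) (fun s => p (s^-1 * x)) t _ _ H2 H1.
apply: (is_derive_eq H).
by rewrite /scale_score; field; rewrite !gt_eqF.
Qed.

Lemma is_derive_qlog_scale_ratio t x : 0 < t ->
  is_derive t 1 (fun s => qlog gamma (scale_ratio s x))
   (scale_ratio t x `^ gamma / t * (1 + scale_score t x)).
Proof.
move=> t0.
have H1 := is_derive_p_scale x t0.
have pn : p (t^-1 * x) != 0 by rewrite gt_eqF.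
have H2 : is_derive t 1 (fun s => (p (s^-1 * x))^-1) _ := is_deriveV pn H1.
have H : is_derive t 1 (fun s => scale_ratio s x)
    (scale_ratio t x / t * (1 + scale_score t x)).
  have -> : (fun s => scale_ratio s x) =
     scale_density p alpha x *: (id * (fun s => (p (s^-1 * x))^-1)).
    apply/funext => s; rewrite /scale_ratio {2}/scale_density invfM invrK.
    by rewrite /GRing.scale.
  apply: is_derive_eq.
  rewrite /GRing.scale/= /scale_score /scale_ratio {3}/scale_density.
  by field; rewrite !gt_eqF.
have H3 := is_derive_qlog gamma (scale_ratio_gt0 x t0).
have H4 := @is_derive1_comp _ (qlog gamma) (fun s => scale_ratio s x) t _ _ H3 H.
apply: (is_derive_eq H4).
rewrite -(mul_powRB1 gamma (scale_ratio_gt0 x t0)); ring.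
Qed.

(** The derivative of [qlog gamma (scale_ratio t x)] in [t]. *)
Definition ratio_score t x := scale_ratio t x `^ gamma / t * (1 + scale_score t x).

Section regularity.
Variables (theta0 : R) (m : R -> R -> R) (I : R -> R).
Hypothesis theta0_gt0 : 0 < theta0.
Hypothesis mE : forall t x, 0 < t -> m t x = I t - qlog gamma (scale_ratio t x).
Hypothesis m_derivable :
  \forall t \near theta0, forall x, derivable (m ^~ x) t 1.

(** Subtracting the value at [x = 0] eliminates the term [I], of which no
regularity is known separately. *)
Lemma derive1_subE x :
  \forall t \near theta0, derive1 (m ^~ x) t - derive1 (m ^~ 0) t =
    ratio_score t 0 - ratio_score t x.
Proof.
near=> t.
have t0 : 0 < t by near: t; exact: lt_nbhsr.
have dm : forall y, derivable (m ^~ y) t 1 by near: t; exact: m_derivable.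
have Hm y : is_derive t 1 (m ^~ y) (derive1 (m ^~ y) t).
  by rewrite derive1E; exact/derivableP/dm.
have H : is_derive t 1 ((m ^~ x) - (m ^~ 0)) (derive1 (m ^~ x) t - derive1 (m ^~ 0) t).
  exact: is_derive_eq.
have Hx := is_derive_qlog_scale_ratio x t0.
have H0 := is_derive_qlog_scale_ratio 0 t0.
have K : is_derive t 1
   ((fun s => qlog gamma (scale_ratio s 0)) - (fun s => qlog gamma (scale_ratio s x)))
   (ratio_score t 0 - ratio_score t x) by exact: is_derive_eq.
have K' : is_derive t 1 ((m ^~ x) - (m ^~ 0)) (ratio_score t 0 - ratio_score t x).
  apply: near_eq_is_derive K; near=> s.
  have s0 : 0 < s by near: s; exact: lt_nbhsr.
  by rewrite -[RHS]/(m s x - m s 0) !mE//= -[LHS]/(_ - _); ring.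
by have [_ <-] := H; have [_ <-] := K'.
Unshelve. all: by end_near. Qed.

Lemma scale_score0 t : scale_score t 0 = 0.
Proof. by rewrite /scale_score mulr0 !mul0r. Qed.

Hypothesis dm_cont : forall x, {for theta0, continuous (derive1 (m ^~ x))}.

(** Solving the formula for [ratio_score] for the derivative of [p] expresses
[p' (x / t)] through quantities that are continuous in [t] at [theta0]; for
[u <> 0], the choice [x = theta0 * u] moves the point [x / t] through a
neighborhood of [u]. *)
Lemma continuous_derive1_off0 u : u != 0 -> {for u, continuous (derive1 p)}.
Proof.
move=> u0.
pose x := theta0 * u.
have x0 : x != 0 by rewrite mulf_neq0// gt_eqF.
have cinv : {for theta0, continuous (fun t : R => t^-1)}.
  by apply: cvgV; [rewrite gt_eqF|exact: cvg_id].
have cinvx : {for theta0, continuous (fun t : R => t^-1 * x)}.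
  by apply: cvgM; [exact: cinv|exact: cvg_cst].
have cp : {for theta0, continuous (fun t : R => p (t^-1 * x))}.
  by apply: continuous_comp; [exact: cinvx|exact: p_cont].
have cpow y : {for theta0, continuous (fun t : R => scale_ratio t y `^ gamma)}.
  apply: (@continuous_comp _ _ _ (fun t => scale_ratio t y) (fun z => z `^ gamma)).
    apply: cvgM; first exact: cvg_cst.
    apply: cvgV; first by rewrite gt_eqF// scale_density_gt0.
    apply: cvgM; first exact: cinv.
    apply: continuous_comp; last exact: p_cont.
    by apply: cvgM; [exact: cinv|exact: cvg_cst].
  apply/differentiable_continuous/derivable1_diffP.
  by have [] := is_derive1_powR gamma (scale_ratio_gt0 y theta0_gt0).
have cS0 : {for theta0, continuous (fun t => ratio_score t 0)}.
  have -> : (fun t => ratio_score t 0) = fun t => scale_ratio t 0 `^ gamma * t^-1.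
    by apply/funext => t; rewrite /ratio_score scale_score0 addr0 mulr1.
  by apply: cvgM; [exact: cpow|exact: cinv].
pose F t := p (t^-1 * x) / (t^-1 * x) *
  (t * (ratio_score t 0 - (derive1 (m ^~ x) t - derive1 (m ^~ 0) t))
     / scale_ratio t x `^ gamma - 1).
have cF : {for theta0, continuous F}.
  apply: cvgM.
    apply: cvgM; first exact: cp.
    apply: cvgV; last exact: cinvx.
    by rewrite mulf_neq0// invr_neq0// gt_eqF.
  apply: cvgB; last exact: cvg_cst.
  apply: cvgM.
    apply: cvgM; first exact: cvg_id.
    apply: cvgB.
      exact: cS0.
    by apply: cvgB; exact: dm_cont.
  apply: cvgV; last exact: cpow.
  by rewrite gt_eqF//; apply: powR_gt0; exact: scale_ratio_gt0.
have cF' : {for theta0, continuous (fun t => derive1 p (t^-1 * x))}.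
  have E : \forall t \near theta0, F t = derive1 p (t^-1 * x).
    near=> t.
    have t0 : 0 < t by near: t; exact: lt_nbhsr.
    have D : derive1 (m ^~ x) t - derive1 (m ^~ 0) t =
      ratio_score t 0 - ratio_score t x by near: t; exact: derive1_subE.
    rewrite /F D /ratio_score /scale_score.
    have r0 : scale_ratio t x `^ gamma != 0.
      by rewrite gt_eqF//; apply: powR_gt0; exact: scale_ratio_gt0.
    by field; rewrite r0 x0 !gt_eqF.
  rewrite /prop_for /continuous_at -(nbhs_singleton E).
  by apply: cvg_trans cF; exact: near_eq_cvg.
have cw : {for u, continuous (fun v : R => x / v)}.
  by apply: cvgM; [exact: cvg_cst|apply: cvgV => //; exact: cvg_id].
have xu : x / u = theta0 by rewrite /x mulfK.
have ux : theta0^-1 * x = u by rewrite /x mulKf// gt_eqF.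
have cc : {for u, continuous ((fun t => derive1 p (t^-1 * x)) \o (fun v : R => x / v))}.
  by apply: continuous_comp; [exact: cw|rewrite xu].
have E : \forall v \near u,
    ((fun t => derive1 p (t^-1 * x)) \o (fun v : R => x / v)) v = derive1 p v.
  near=> v.
  have v0 : v != 0.
    by near: v; apply: (cvgr_neq0 _ _ u0); exact: cvg_id.
  by rewrite /= invfM invrK mulrAC mulVf// mul1r.
rewrite /prop_for /continuous_at -(nbhs_singleton E).
by apply: cvg_trans cc; exact: near_eq_cvg.
Unshelve. all: by end_near. Qed.

End regularity.

End ratio.

(** * Boundedness of the density ratio and of its score *)

Section ereal_sup_range.
Context {R : realType} {T : Type}.
Implicit Type f : T -> R.

Lemma ereal_sup_range_ltyP f :
  (ereal_sup (range (fun x => (f x)%:E)) < +oo)%E <-> exists K, forall x, f x <= K.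
Proof.
split=> [|[K fK]]; last first.
  apply: (@le_lt_trans _ _ K%:E); last exact: ltry.
  by apply: ge_ereal_sup => _ [x _ <-]; rewrite lee_fin.
have ub x : ((f x)%:E <= ereal_sup (range (fun x => (f x)%:E)))%E.
  by apply: ereal_sup_ubound; exists x.
case: (ereal_sup _) ub => // [r|] ub _.
  by exists r => x; rewrite -lee_fin.
by exists 0 => x; have := ub x; rewrite leeNy_eq.
Qed.

End ereal_sup_range.

Section bounds.
Context {R : realType}.
Variable p : R -> R.
Hypothesis p_gt0 : forall x, 0 < p x.
Hypothesis p_derivable : forall x, derivable p x 1.
Variables (alpha gamma theta0 : R).
Hypothesis alpha_gt0 : 0 < alpha.
Hypothesis theta0_gt0 : 0 < theta0.
Hypothesis gamma_neq0 : gamma != 0.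
Implicit Types t x s : R.

Let rho x := p (alpha^-1 * x) / p (theta0^-1 * x).

Let rho_gt0 x : 0 < rho x.
Proof. by rewrite divr_gt0. Qed.

Lemma powR_bounded_ratio :
  (0 < gamma -> exists K, forall x, rho x <= K) ->
  (gamma < 0 -> exists K, forall x, p (theta0^-1 * x) / p (alpha^-1 * x) <= K) ->
  exists K, forall x, rho x `^ gamma <= K.
Proof.
move=> H2 H3; case: (ltgtP gamma 0) gamma_neq0 => // g0 _.
- have [K hK] := H3 g0; exists (K `^ (- gamma)) => x.
  have -> : rho x `^ gamma = ((rho x)^-1) `^ (- gamma).
    by rewrite -powR_inv1 ?(ltW (rho_gt0 x))// -powRrM mulrN mulN1r opprK.
  have h : (rho x)^-1 <= K by rewrite /rho invf_div.
  apply: ge0_ler_powR => //; first lra.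
    by rewrite nnegrE invr_ge0 ltW.
  by rewrite nnegrE (le_trans _ h)// invr_ge0 ltW.
- have [K hK] := H2 g0; exists (K `^ gamma) => x.
  apply: ge0_ler_powR => //; first exact: ltW.
    by rewrite nnegrE ltW.
  by rewrite nnegrE (le_trans _ (hK x))// ltW.
Qed.

Lemma scale_ratio_rho x : scale_ratio p alpha theta0 x = theta0 / alpha * rho x.
Proof.
rewrite /scale_ratio /scale_density /rho; field.
by rewrite !gt_eqF.
Qed.

Lemma powR_scale_ratio_rho x : scale_ratio p alpha theta0 x `^ gamma =
  (theta0 / alpha) `^ gamma * rho x `^ gamma.
Proof. by rewrite scale_ratio_rho powRM// ltW// divr_gt0. Qed.

(** The constant term of [1 + scale_score] is controlled by the bound on the power
of the ratio, the other one by the bound on the weighted score. *)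
Lemma ratio_score_bounded :
  (exists K, forall x, rho x `^ gamma <= K) ->
  (exists K, forall x,
     `|derive1 (fun t => ln (p (t^-1 * x))) theta0 * rho x `^ gamma| <= K) ->
  exists K, forall x, `|ratio_score p alpha gamma theta0 x| <= K.
Proof.
move=> [K1 hK1] [K2 hK2]; exists ((theta0 / alpha) `^ gamma * (K1 / theta0 + K2)) => x.
rewrite /ratio_score powR_scale_ratio_rho -!mulrA normrM.
rewrite ger0_norm ?powR_ge0// ler_wpM2l ?powR_ge0//.
have := hK2 x; rewrite derive1E.
have /@derive_val -> := is_derive_ln_p_scale p_gt0 p_derivable x theta0_gt0.
move=> h2; rewrite 2!mulrDr mulr1 (le_trans (ler_normD _ _))// lerD//.
  by rewrite ger0_norm ?divr_ge0 ?powR_ge0 ?(ltW theta0_gt0)// ler_pM2r ?invr_gt0.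
rewrite -normrN; apply: le_trans h2; rewrite le_eqVlt; apply/orP; left; apply/eqP.
by congr `|_|; ring.
Qed.

(** Away from [theta0] the densities differ by a fixed factor, on one of two fixed
intervals. If [t] is not small, look near 0: there [p (x / t)] and
[p (x / theta0)] are both close to [p 0 > 0], and the factors [t^-1] and
[theta0^-1] differ. If [t] is small, look at [[1, 2]]: there [t^-1 * p (x / t)] is [x^-1] times [u * p u] at the
large point [u = x / t]. *)
Lemma density_ratio_away (eta : R) : 0 < eta -> eta < theta0 ->
  (forall eps : R, 0 < eps ->
     exists2 N : R, 0 < N & forall u : R, N <= u -> u * p u <= eps) ->
  exists k l, [/\ 1 < k, 0 < l & forall t, 0 < t -> eta <= `|t - theta0| ->
   (forall x, 0 <= x <= l -> k * scale_density p theta0 x <= scale_density p t x) \/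
   (forall x, 0 <= x <= l -> k * scale_density p t x <= scale_density p theta0 x) \/
   (forall x, 1 <= x <= 2 -> k * scale_density p t x <= scale_density p theta0 x)].
Proof.
move=> eta0 etat tail.
have p_cont : continuous p.
  by move=> x; exact/differentiable_continuous/derivable1_diffP.
(* k ^+ 3 <= 1 + eta / theta0: one factor k for the conclusion, two for the
   variation of p near 0; the 7 comes from (1 + z) ^+ 3 <= 1 + 7 z on [0, 1]. *)
pose k := 1 + eta / (7 * theta0).
have e0 : 0 < eta / (7 * theta0) by rewrite divr_gt0// mulr_gt0.
have e1 : eta / (7 * theta0) < 1 by rewrite ltr_pdivrMr ?mulr_gt0//; lra.
have k1 : 1 < k by rewrite /k; lra.
have k2 : k <= 2 by rewrite /k; lra.
have k3 : k ^+ 3 <= 1 + eta / theta0.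
  have -> : eta / theta0 = 7 * (eta / (7 * theta0)) by field; rewrite gt_eqF.
  by rewrite /k; nra.
have k3t : k ^+ 3 * theta0 <= theta0 + eta.
  by apply: (le_trans (ler_wpM2r (ltW theta0_gt0) k3)); rewrite mulrDl mul1r divfK ?gt_eqF.
have [||c cI cmin] := @EVT_min _ (scale_density p theta0) 1 2; first lra.
  by apply: continuous_subspaceT => x; exact: continuous_scale_density.
have cpos : 0 < scale_density p theta0 c by exact: scale_density_gt0.
have chalf : 0 < scale_density p theta0 c / 2 by rewrite divr_gt0.
have [N0 N00 hN] := tail _ chalf.
have : \forall u \near 0, k^-1 * p 0 < p u < k * p 0.
  have p0 := p_gt0 0.
  near=> u; apply/andP; split.
    near: u; apply: (cvgr_gt (p 0) (p_cont 0)).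
    by rewrite gtr_pMl// invf_lt1//; lra.
  near: u; apply: (cvgr_lt (p 0) (p_cont 0)).
  by rewrite ltr_pMl.
move=> /nbhs_ballP[d /= d0 hd].
have {}hd u : 0 <= u -> u < d -> p 0 <= k * p u /\ p u <= k * p 0.
  move=> u0 ud; have [|h1 h2] := andP (hd u _).
    by rewrite /ball/= sub0r normrN ger0_norm.
  split; last exact: ltW.
  by rewrite -ler_pdivrMl; [exact: ltW|lra].
pose b := Num.min N0^-1 theta0.
have b0 : 0 < b by rewrite lt_min invr_gt0 N00.
exists k, (d / 2 * b); split => //; first by rewrite mulr_gt0// divr_gt0.
move=> t t0 ht.
have inv x s : b <= s -> 0 <= x <= d / 2 * b -> 0 <= s^-1 * x /\ s^-1 * x < d.
  move=> bs /andP[x0 xl]; have s0 : 0 < s by lra.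
  split; first by rewrite mulr_ge0// invr_ge0 ltW.
  rewrite mulrC ltr_pdivrMr// (le_lt_trans xl)//.
  rewrite (@le_lt_trans _ _ (d / 2 * s))// ?ler_pM2l//; first lra.
  by rewrite ltr_pM2r//; lra.
have bt : b <= theta0 by rewrite ge_min lexx orbT.
have [tN|tN] := leP N0^-1 t.
  have bt' : b <= t by rewrite ge_min tN.
  have key x s1 s2 : b <= s1 -> b <= s2 -> k ^+ 3 * s1 <= s2 -> 0 <= x <= d / 2 * b ->
      k * scale_density p s2 x <= scale_density p s1 x.
    move=> bs1 bs2 h xl.
    have [a1 a2] := inv x s1 bs1 xl; have [a3 a4] := inv x s2 bs2 xl.
    have [q1 _] := hd _ a1 a2; have [_ q2] := hd _ a3 a4.
    have s10 : 0 < s1 by lra.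
    have s20 : 0 < s2 by lra.
    have q : p (s2^-1 * x) <= k ^+ 2 * p (s1^-1 * x).
      by apply: (le_trans q2); rewrite expr2 -mulrA ler_wpM2l//; lra.
    have h' : k ^+ 3 * s2^-1 <= s1^-1 by rewrite ler_pdivrMr// ler_pdivlMl// mulrC.
    have ps := ltW (p_gt0 (s1^-1 * x)).
    apply: (@le_trans _ _ (k * (s2^-1 * (k ^+ 2 * p (s1^-1 * x))))).
      by rewrite /scale_density ler_wpM2l ?ler_wpM2l ?invr_ge0//; lra.
    have -> : k * (s2^-1 * (k ^+ 2 * p (s1^-1 * x))) = k ^+ 3 * s2^-1 * p (s1^-1 * x).
      by ring.
    exact: ler_wpM2r.
  have K1 : 1 <= k ^+ 3 by rewrite exprn_ege1// ltW.
  have [tt|tt] := leP t theta0.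
    left => x xl; apply: key => //.
    have {}ht : t <= theta0 - eta by move: ht; rewrite ler0_norm; lra.
    have := ler_wpM2l (le_trans ler01 K1) ht.
    have : eta <= k ^+ 3 * eta by rewrite ler_peMl// ltW.
    by rewrite mulrBr; lra.
  right; left => x xl; apply: key => //.
  by move: ht; rewrite gtr0_norm; lra.
right; right => x x12; have /andP[x1 x2] := x12.
have hu : N0 <= t^-1 * x.
  apply: (@le_trans _ _ t^-1).
    by rewrite -[N0]invrK lef_pV2 ?posrE ?invr_gt0// ltW.
  by rewrite ler_peMr// invr_ge0 ltW.
apply: (@le_trans _ _ (2 * (scale_density p theta0 c / 2))).
  apply: (@le_trans _ _ (2 * scale_density p t x)).
    by rewrite ler_wpM2r// ltW// scale_density_gt0.
  rewrite ler_wpM2l//; apply: le_trans (hN _ hu).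
  by rewrite /scale_density ler_wpM2r ?(ltW (p_gt0 _))// ler_peMr// invr_ge0 ltW.
by rewrite mulrC divfK// cmin.
Unshelve. all: by end_near. Qed.

End bounds.

(** * Growth and separation of the dual criterion *)

(** Here [w] is the loss [m0 - m] of the uncontaminated criterion, [v] and [u] are
the contributions of the contaminating point: a gain [u - v] at most
proportional to [w] cannot compensate the loss when [e] is small. *)
Lemma contamination_gain {R : realFieldType} (a b d e w u v m m0 : R) :
  0 < d -> d <= w -> 0 <= b -> 0 < e -> e * (1 + (`|a| + `|v|) / d + b) < 1 ->
  u <= a + b * w -> m0 - m = w -> (1 - e) * m + e * u < (1 - e) * m0 + e * v.
Proof.
move=> d0 dw b0 e0 ek uab mw.
have w0 : 0 < w := lt_le_trans d0 dw.
set k := (_ / d) in ek.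
have kw : `|a| + `|v| <= k * w.
  have -> : `|a| + `|v| = k * d by rewrite divfK// gt_eqF.
  by rewrite ler_wpM2l// divr_ge0 ?addr_ge0// ltW.
have := ler_norm a; have := ler_norm (- v); rewrite normrN => h1 h2.
have F : e * (u - v) <= e * ((k + b) * w).
  by rewrite ler_pM2l// mulrDl; lra.
have : e * (1 + k + b) * w < w by rewrite gtr_pMl.
have -> : e * (1 + k + b) * w = e * w + e * ((k + b) * w) by ring.
have -> : m0 = w + m by rewrite -mw subrK.
rewrite !mulrDr !mulrBl !mul1r; move: F; rewrite mulrBr.
lra.
Qed.

Section criterion.
Context {R : realType}.
Variables (p : R -> R) (Theta : set R)
  (P : R -> probability (measurableTypeR R) R) (alpha gamma theta0 : R).
Hypothesis p_gt0 : forall x, 0 < p x.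
Hypothesis p_derivable : forall x, derivable p x 1.
Hypothesis Theta_gt0 : forall theta, Theta theta -> 0 < theta.
Hypothesis P_density : forall theta, Theta theta ->
  has_density (P theta) (scale_density p theta).
Hypothesis gamma_neq0 : gamma != 0.
Hypothesis alphaT : Theta alpha.
Hypothesis theta0T : Theta theta0.
Implicit Types t x s : R.

Let q := scale_density p.
Let r := scale_ratio p alpha.
Let L := @qlog R.
Let I t := Rintegral (P alpha) setT (fun x => L (gamma - 1) (r t x)).
Let P0 := P theta0.

Hypothesis dphi_integrable : forall theta, Theta theta ->
  (P alpha).-integrable setT (EFin \o (fun x => L (gamma - 1) (r theta x))).
Hypothesis powr_bounded : exists K, forall x, r theta0 x `^ gamma <= K.

Let alpha0 : 0 < alpha := Theta_gt0 alphaT.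
Let theta00 : 0 < theta0 := Theta_gt0 theta0T.

Let q_gt0 t x : Theta t -> 0 < q t x.
Proof. by move=> /Theta_gt0 t0; exact: scale_density_gt0. Qed.

Let mq t : measurable_fun setT (q t).
Proof. by apply: continuous_measurable_fun; exact: continuous_scale_density. Qed.

Let r_gt0 t x : Theta t -> 0 < r t x.
Proof. by move=> /Theta_gt0 t0; exact: scale_ratio_gt0. Qed.

Let mr t : Theta t -> measurable_fun setT (r t).
Proof.
move=> /Theta_gt0 t0.
by apply: continuous_measurable_fun; exact: continuous_scale_ratio.
Qed.

Let mL s t : Theta t -> measurable_fun setT (fun x => L s (r t x)).
Proof.
move=> /Theta_gt0 t0.
by apply: continuous_measurable_fun; exact: continuous_qlog_scale_ratio.
Qed.

(** The measure [P alpha] has density [r t] with respect to [P t]. *)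
Local Lemma change_to t (h : R -> R) : Theta t ->
  measurable_fun setT h ->
  Rintegral (P alpha) setT h = Rintegral (P t) setT (fun x => r t x * h x).
Proof.
move=> Tt mh; rewrite /Rintegral; congr fine.
apply: (@integral_change_density _ (P alpha) (P t) (q alpha) (q t)) => //.
- by move=> x; exact: q_gt0.
- exact: P_density.
- by move=> x; exact: q_gt0.
- exact: P_density.
- exact: mr.
Qed.

Local Lemma change_to_integrable t (h : R -> R) : Theta t ->
  (P alpha).-integrable setT (EFin \o h) ->
  (P t).-integrable setT (EFin \o (fun x => r t x * h x)).
Proof.
move=> Tt ih.
apply: (@integrable_change_density _ (P alpha) (P t) (q alpha) (q t)) => //.
- by move=> x; exact: q_gt0.
- exact: P_density.
- by move=> x; exact: q_gt0.
- exact: P_density.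
- exact: mr.
Qed.

Let icst (Q : probability (measurableTypeR R) R) (c : R) :
  Q.-integrable setT (EFin \o (cst c)).
Proof. exact: finite_measure_integrable_cst. Qed.

Let r0_int : P0.-integrable setT (EFin \o r theta0).
Proof.
have := change_to_integrable theta0T (icst (P alpha) 1).
by apply: eq_integrable => // x _ /=; rewrite mulr1.
Qed.

Let dphi_int t : Theta t ->
  P0.-integrable setT (EFin \o (fun x => r theta0 x * L (gamma - 1) (r t x))).
Proof. by move=> Tt; apply: change_to_integrable => //; exact: dphi_integrable. Qed.

Let IE t : Theta t ->
  I t = Rintegral P0 setT (fun x => r theta0 x * L (gamma - 1) (r t x)).
Proof. by move=> Tt; rewrite /I (change_to theta0T)//; exact: mL. Qed.

Lemma qlog_ratio_integrable : P0.-integrable setT (EFin \o (fun x => L gamma (r theta0 x))).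
Proof.
have [K hK] := powr_bounded.
have K0 : 0 <= K by rewrite (le_trans _ (hK 0))// powR_ge0.
apply: (@le_integrable _ _ _ P0 _ _ _ (EFin \o cst ((K + 1) / `|gamma|))) => //.
- by apply/measurable_EFinP; exact: mL.
- move=> x _; rewrite /= lee_fin [leRHS]ger0_norm; last first.
    by rewrite divr_ge0//; lra.
  rewrite /L /qlog (negbTE gamma_neq0) normf_div ler_pM2r ?invr_gt0 ?normr_gt0//.
  rewrite (le_trans (ler_normB _ _))// normr1 lerD2r ger0_norm ?powR_ge0//.
- exact: icst.
Qed.

(** The Cressie-Read function at [s * r theta0 x]. *)
Let phi s x := s * r theta0 x * L (gamma - 1) (s * r theta0 x) - L gamma (s * r theta0 x).

Let phi_int s : 0 < s -> P0.-integrable setT (EFin \o phi s).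
Proof.
move=> s0.
have := qlog_ratio_integrable => i1; have := dphi_int theta0T => i2.
have i3 : P0.-integrable setT
  ((fun x => (s * L (gamma - 1) s)%:E * (r theta0 x)%:E)
   \+ (fun x => (s * s `^ (gamma - 1))%:E * (r theta0 x * L (gamma - 1) (r theta0 x))%:E))%E.
  apply: integrableD => //; first exact: integrableZl r0_int.
  exact: integrableZl i2.
have i4 : P0.-integrable setT
  ((EFin \o (cst (L gamma s))) \+ (fun x => (s `^ gamma)%:E * (L gamma (r theta0 x))%:E))%E.
  apply: integrableD => //; first exact: icst.
  exact: integrableZl i1.
have := integrableB measurableT i3 i4.
apply: eq_integrable => // x _; rewrite /= -?EFinM -?EFinD -?EFinB; congr (_%:E).
have rx := r_gt0 x theta0T.
by rewrite /phi /L (qlogM (gamma - 1) s0 rx) (qlogM gamma s0 rx); ring.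
Qed.

Let Phi s := Rintegral P0 setT (phi s).

(** Nonnegativity of the Bregman divergence between [s * r theta0 x] and [r t x],
which is the tangent inequality of the convex divergence function. *)
Local Lemma bregman_tangent s t x : 0 < s -> Theta t ->
  - L gamma (r t x) <= phi s x - s * (r theta0 x * L (gamma - 1) (r t x)).
Proof.
move=> s0 Tt.
have a0 : 0 < s * r theta0 x by rewrite mulr_gt0 ?r_gt0.
have := qbregman_ge0 gamma a0 (r_gt0 x Tt).
rewrite /qbregman /phi /L mulrBr mulrA; lra.
Qed.

(** This is [bregman_tangent] with [s = 1]. Hence the criterion is either finite or
-oo at every parameter. *)
Local Lemma criterion_ub t : Theta t -> exists2 u : R -> R,
  P0.-integrable setT (EFin \o u) & forall x, I t - L gamma (r t x) <= u x.
Proof.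
move=> Tt.
exists (fun x => I t + (phi 1 x - 1 * (r theta0 x * L (gamma - 1) (r t x)))).
  have := integrableD measurableT (icst P0 (I t)) (integrableB measurableT
    (phi_int ltr01) (integrableZl measurableT 1 (dphi_int Tt))).
  by apply: eq_integrable => // x _.
by move=> x; rewrite lerD2l; exact: bregman_tangent.
Qed.

(** The loss [M theta0 - M t] (see [criterion_gap]). *)
Let Delta t := Rintegral P0 setT (fun x => qbregman gamma (r theta0 x) (r t x)).
Let M t := Rintegral P0 setT (fun x => I t - L gamma (r t x)).

Section integrable_criterion.
Variable t : R.
Hypothesis Tt : Theta t.
Hypothesis psi_int : P0.-integrable setT (EFin \o (fun x => L gamma (r t x))).

Let Psi := Rintegral P0 setT (fun x => L gamma (r t x)).

Local Lemma criterion_intE : M t = I t - Psi.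
Proof.
rewrite /M RintegralB//; last exact: (icst P0 (I t)).
by rewrite Rintegral_cst//= probability_setT mulr1.
Qed.

Let bregmanE s x : 0 < s -> qbregman gamma (s * r theta0 x) (r t x) =
  phi s x - s * (r theta0 x * L (gamma - 1) (r t x)) + L gamma (r t x).
Proof. by move=> s0; rewrite /qbregman /phi /L; ring. Qed.

Let i1 s : P0.-integrable setT (EFin \o (fun x => s * (r theta0 x * L (gamma - 1) (r t x)))).
Proof.
have := integrableZl measurableT s (dphi_int Tt).
by apply: eq_integrable.
Qed.

Let i2 s : 0 < s -> P0.-integrable setT
  (EFin \o (fun x => phi s x - s * (r theta0 x * L (gamma - 1) (r t x)))).
Proof.
move=> s0; have := integrableB measurableT (phi_int s0) (i1 s).
by apply: eq_integrable.
Qed.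

Let int_bregman s : 0 < s ->
  Rintegral P0 setT (fun x => qbregman gamma (s * r theta0 x) (r t x)) =
  Phi s - s * I t + Psi.
Proof.
move=> s0; under eq_Rintegral do rewrite bregmanE//.
rewrite (RintegralD measurableT (i2 s0) psi_int).
rewrite (RintegralB measurableT (phi_int s0) (i1 s)).
by rewrite RintegralZl ?IE//; exact: dphi_int.
Qed.

Local Lemma DeltaE : Delta t = Phi 1 - I t + Psi.
Proof.
have := int_bregman ltr01; rewrite mul1r => <-.
by apply: eq_Rintegral => x _; rewrite mul1r.
Qed.

(** Integrated form of [bregman_tangent]: up to constants, it bounds [I t] from
above by the loss [Delta t] for [s = 2], and from below by [- 2 * Delta t] for
[s = 2^-1]. *)
Local Lemma bregman_tangent_int s : 0 < s -> (s - 1) * I t <= Phi s - Phi 1 + Delta t.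
Proof.
move=> s0.
have : 0 <= Phi s - s * I t + Psi.
  rewrite -int_bregman//; apply: Rintegral_ge0 => x _.
  apply: qbregman_ge0; last exact: r_gt0.
  by apply: mulr_gt0 => //; exact: r_gt0.
rewrite DeltaE; move: (Phi s) (Phi 1) (I t) Psi => a b i c h.
have -> : (s - 1) * i = a - b + (b - i + c) - (a - s * i + c) by ring.
by rewrite gerBl.
Qed.

Local Lemma bregman_int : P0.-integrable setT
  (EFin \o (fun x => qbregman gamma (r theta0 x) (r t x))).
Proof.
have := integrableD measurableT (i2 ltr01) psi_int.
by apply: eq_integrable => // x _ /=; rewrite -EFinD -bregmanE// mul1r.
Qed.

End integrable_criterion.

Local Lemma criterion_gap t : Theta t ->
  P0.-integrable setT (EFin \o (fun x => L gamma (r t x))) ->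
  M theta0 - M t = Delta t.
Proof.
move=> Tt it; rewrite DeltaE// !criterion_intE//; last exact: qlog_ratio_integrable.
have : Delta theta0 = 0.
  have -> : Delta theta0 = Rintegral P0 setT (cst 0).
    by apply: eq_Rintegral => x _; rewrite /qbregman !subrr mulr0 subrr.
  by rewrite Rintegral_cst//= mul0r.
rewrite DeltaE//; last exact: qlog_ratio_integrable.
move: (Phi 1) (I theta0) (I t) (Rintegral _ _ _) (Rintegral _ _ _) => a b c d e h.
by rewrite -[RHS]subr0 -h; ring.
Qed.

Let q_cont t : continuous (q t).
Proof. exact: continuous_scale_density. Qed.

Local Lemma probability_itv_ge t a b c : Theta t -> a < b -> 0 <= c ->
  (forall x, a <= x <= b -> c <= q t x) -> c * (b - a) <= fine (P t `[a, b]).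
Proof.
move=> Tt ab c0 cq.
have fin : P t `[a, b] \is a fin_num by exact: fin_num_measure.
rewrite -lee_fin fineK// (P_density Tt)//.
have -> : ((c * (b - a))%:E = \int[lebesgue_measure]_(x in `[a, b]) c%:E)%E.
  by rewrite integral_cst//= lebesgue_measure_itv/= lte_fin ab -EFinD.
apply: ge0_le_integral => //.
by apply/measurable_EFinP/measurable_funTS; exact: mq.
Qed.

Local Lemma Rintegral_ge (Q : probability (measurableTypeR R) R) (F : R -> R) a b w :
  Q.-integrable setT (EFin \o F) -> (forall x, 0 <= F x) ->
  (forall x, a <= x <= b -> w <= F x) ->
  w * fine (Q `[a, b]) <= Rintegral Q setT F.
Proof.
move=> iF F0 wF.
have iF' : Q.-integrable `[a, b] (EFin \o F) by apply: integrableS iF.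
apply: (@le_trans _ _ (Rintegral Q `[a, b] F)).
  rewrite -Rintegral_cst//; apply: le_Rintegral => //.
  by apply: integrableS (icst Q w).
rewrite /Rintegral fine_le ?integrable_fin_num//.
apply: ge0_subset_integral => //; first exact: measurable_int iF.
by move=> x _; rewrite lee_fin.
Qed.

Local Lemma Rintegral_lower_bound a b g : a < b -> 0 < g -> exists2 c, 0 < c &
  forall F : R -> R, P0.-integrable setT (EFin \o F) -> (forall x, 0 <= F x) ->
  (forall x, a <= x <= b -> r theta0 x `^ gamma * g <= F x) ->
  c <= Rintegral P0 setT F.
Proof.
move=> ab g0.
have [||u uI umin] := @EVT_min _ (fun x => r theta0 x `^ gamma) a b.
- exact: ltW.
- apply: continuous_subspaceT => x.
  apply: (@continuous_comp _ _ _ (r theta0) (fun z => z `^ gamma)).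
    exact: continuous_scale_ratio.
  apply/differentiable_continuous/derivable1_diffP.
  by have [] := is_derive1_powR gamma (r_gt0 x theta0T).
have [||v vI vmin] := @EVT_min _ (q theta0) a b; first exact: ltW.
  by apply: continuous_subspaceT => x; exact: q_cont.
have u0 : 0 < r theta0 u `^ gamma by apply: powR_gt0; exact: r_gt0.
have v0 : 0 < q theta0 v by exact: q_gt0.
exists (r theta0 u `^ gamma * g * (q theta0 v * (b - a))).
  by do 2 apply: mulr_gt0 => //; rewrite subr_gt0.
move=> F iF F0 hF.
apply: (@le_trans _ _ (r theta0 u `^ gamma * g * fine (P0 `[a, b]))).
  apply: ler_wpM2l; first by rewrite ltW// mulr_gt0.
  by apply: probability_itv_ge => //; exact: ltW.
apply: Rintegral_ge => // x xab; apply: le_trans (hF x xab).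
by apply: ler_wpM2r; [exact: ltW|exact: umin].
Qed.

Local Lemma qbregman_ratio t x : Theta t ->
  qbregman gamma (r theta0 x) (r t x) =
  r theta0 x `^ gamma * qgap gamma (q theta0 x / q t x).
Proof.
move=> Tt; rewrite -qbregmanE; last 2 first.
- exact: r_gt0.
- by apply: divr_gt0; exact: q_gt0.
congr qbregman; rewrite /r /scale_ratio -/(q theta0 x) mulrA divfK//.
by rewrite gt_eqF// q_gt0.
Qed.

(** The loss is a Bregman divergence, homogeneous in the ratio [q theta0 / q t],
which stays away from 1 on one of two fixed intervals. *)
Lemma criterion_separation eta : 0 < eta ->
  (forall eps : R, 0 < eps ->
     exists2 N : R, 0 < N & forall u : R, N <= u -> u * p u <= eps) ->
  exists2 delta, 0 < delta & forall t, Theta t -> eta <= `|t - theta0| ->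
    P0.-integrable setT (EFin \o (fun x => L gamma (r t x))) -> delta <= Delta t.
Proof.
move=> eta0 tail.
pose e := Num.min eta (theta0 / 2).
have e0 : 0 < e by rewrite lt_min eta0 divr_gt0.
have et : e < theta0 by rewrite gt_min; apply/orP; right; have := theta00; lra.
have [k [l [k1 l0 H]]] := density_ratio_away p_gt0 p_derivable theta00 e0 et tail.
have k0 : 0 < k by exact: lt_trans k1.
pose g := Num.min (qgap gamma k) (qgap gamma k^-1).
have g0 : 0 < g.
  have kk : k^-1 < 1 by rewrite invf_lt1.
  by rewrite lt_min !qgap_gt0 ?invr_gt0 ?(gt_eqF k1) ?(lt_eqF kk).
have [c1 c10 h1] := Rintegral_lower_bound l0 g0.
have [c2 c20 h2] := Rintegral_lower_bound (ltr1n R 2) g0.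
exists (Num.min c1 c2); first by rewrite lt_min c10.
move=> t Tt et' it.
have iB := bregman_int Tt it.
have B0 x : 0 <= qbregman gamma (r theta0 x) (r t x).
  by apply: qbregman_ge0; exact: r_gt0.
have up x : k * q t x <= q theta0 x ->
    r theta0 x `^ gamma * g <= qbregman gamma (r theta0 x) (r t x).
  move=> h; rewrite qbregman_ratio//; apply: ler_wpM2l; first exact: powR_ge0.
  rewrite /g ge_min; apply/orP; left; apply: qgap_ndecr; first exact: ltW.
  by rewrite ler_pdivlMr// q_gt0.
have dn x : k * q theta0 x <= q t x ->
    r theta0 x `^ gamma * g <= qbregman gamma (r theta0 x) (r t x).
  move=> h; rewrite qbregman_ratio//; apply: ler_wpM2l; first exact: powR_ge0.
  rewrite /g ge_min; apply/orP; right; apply: qgap_nincr.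
  - by rewrite divr_gt0 ?q_gt0.
  - by rewrite ler_pdivrMr ?q_gt0// ler_pdivlMl.
  - by rewrite invf_le1// ltW.
have ee : e <= `|t - theta0| by rewrite (le_trans _ et')// ge_min lexx.
rewrite ge_min; have [h|[h|h]] := H t (Theta_gt0 Tt) ee.
- by apply/orP; left; apply: h1 => // x /h; exact: dn.
- by apply/orP; left; apply: h1 => // x /h; exact: up.
- by apply/orP; right; apply: h2 => // x /h; exact: up.
Qed.

(** For [gamma > 0], [qlog gamma] is bounded below and [bregman_tangent_int] bounds [I t].
For [gamma < 0], [I t] is bounded above, but [- qlog gamma (r t x)] may explode,
like [t `^ gamma] at most since [p] is bounded. That power is compensated by
[- I t], an affine function of [\int (r t) `^ (gamma - 1) dP_alpha], which is at
least of the order of [t `^ gamma], as one sees on the segment [[0, t]], of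
[P t]-probability bounded below. *)
Lemma criterion_growth x : (exists B, forall u, p u <= B) ->
  exists a b, 0 <= b /\ forall t, Theta t ->
    P0.-integrable setT (EFin \o (fun x => L gamma (r t x))) ->
    I t - L gamma (r t x) <= a + b * Delta t.
Proof.
move=> [B hB].
case: (ltgtP gamma 0) gamma_neq0 => // g0 _; last first.
  exists (Phi 2 - Phi 1 + gamma^-1), 1; split => // t Tt it.
  have := bregman_tangent_int Tt it (ltr0n R 2).
  have := qlog_ge_pos (r t x) g0.
  have -> : 2 - 1 = 1 :> R by ring.
  rewrite !mul1r -/(L gamma _) => h1 h2.
  rewrite -addrA [_ + Delta t]addrC addrA; apply: lerD => //.
  by rewrite lerNl.
have B0 : 0 < B by exact: lt_le_trans (hB 0).
have q_ub t y : Theta t -> q t y <= B / t.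
  by move=> /Theta_gt0 t0; rewrite /q /scale_density mulrC ler_pM2r ?invr_gt0.
have powR_anti u v : 0 < u -> u <= v -> v `^ gamma <= u `^ gamma.
  move=> u0 uv; have v0 := lt_le_trans u0 uv.
  rewrite -[gamma]opprK !(powRN _ (- gamma)) lef_pV2 ?posrE ?powR_gt0//.
  by apply: ge0_ler_powR => //; rewrite ?nnegrE ?oppr_ge0 ?ltW.
have I_ub t : Theta t -> I t <= (1 - gamma)^-1.
  move=> Tt.
  have -> : (1 - gamma)^-1 = Rintegral (P alpha) setT (cst (1 - gamma)^-1).
    by rewrite Rintegral_cst//= probability_setT mulr1.
  apply: le_Rintegral => //; first exact: dphi_integrable.
    exact: icst.
  move=> y _ /=; have -> : (1 - gamma)^-1 = - (gamma - 1)^-1.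
    by rewrite -invrN opprB.
  by apply: qlog_le_neg; rewrite subr_lt0 (lt_trans g0).
have [||v vI vmin] := @EVT_min _ p 0 1; first exact: ler01.
  apply: continuous_subspaceT => y.
  exact/differentiable_continuous/derivable1_diffP.
pose kap := B / alpha / p v.
have kap0 : 0 < kap by rewrite !divr_gt0.
pose c := kap `^ gamma * p v.
have c0 : 0 < c by rewrite mulr_gt0// powR_gt0.
have J t : Theta t -> c * t `^ gamma <= 1 + (1 - gamma) * - I t.
  move=> Tt; have t0 := Theta_gt0 Tt.
  have g1 : gamma - 1 != 0 by rewrite lt_eqF// subr_lt0 (lt_trans g0).
  have iL := dphi_integrable Tt.
  have ipow : (P alpha).-integrable setT (EFin \o (fun y => r t y `^ (gamma - 1))).
    have := integrableD measurableT (icst (P alpha) 1)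
      (integrableZl measurableT (gamma - 1) iL).
    by apply: eq_integrable => // y _ /=; rewrite powR_qlog.
  have -> : 1 + (1 - gamma) * - I t =
      Rintegral (P alpha) setT (fun y => r t y `^ (gamma - 1)).
    under eq_Rintegral do rewrite powR_qlog//.
    have iZ : (P alpha).-integrable setT
        (EFin \o (fun y => (gamma - 1) * L (gamma - 1) (r t y))).
      have := integrableZl measurableT (gamma - 1) iL.
      by apply: eq_integrable.
    rewrite (RintegralD measurableT (icst (P alpha) 1) iZ).
    by rewrite Rintegral_cst//= probability_setT RintegralZl// -/(I t) /=; ring.
  rewrite (change_to Tt); last by have /measurable_EFinP := measurable_int _ ipow.
  under eq_Rintegral do rewrite mul_powRB1 ?r_gt0//.
  have ir : (P t).-integrable setT (EFin \o (fun y => r t y `^ gamma)).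
    have := change_to_integrable Tt ipow.
    by apply: eq_integrable => // y _ /=; rewrite mul_powRB1// r_gt0.
  have r_le y : 0 <= y <= t -> r t y <= kap * t.
    move=> /andP[y0 yt]; rewrite /r /scale_ratio ler_pdivrMr; last exact: q_gt0.
    apply: (le_trans (q_ub alpha y alphaT)).
    have -> : kap * t * scale_density p t y = B / alpha * (p (t^-1 * y) / p v).
      by rewrite /kap /scale_density; field; rewrite !gt_eqF.
    rewrite ler_peMr//; first by rewrite ltW// divr_gt0.
    rewrite ler_pdivlMr// mul1r; apply: vmin; rewrite in_itv/=.
    by rewrite mulr_ge0 ?invr_ge0 ?(ltW t0)//= ler_pdivrMl// mulr1.
  apply: (@le_trans _ _ ((kap * t) `^ gamma * fine (P t `[0, t]))).
    have -> : c * t `^ gamma = (kap * t) `^ gamma * p v.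
      by rewrite powRM ?ltW// /c; ring.
    apply: ler_wpM2l; first exact: powR_ge0.
    have := @probability_itv_ge t 0 t (p v / t) Tt t0.
    rewrite subr0 divfK ?gt_eqF//; apply; first by rewrite ltW// divr_gt0.
    move=> y /andP[y0 yt]; rewrite /q /scale_density mulrC ler_pM2l ?invr_gt0//.
    apply: vmin; rewrite in_itv/=.
    by rewrite mulr_ge0 ?invr_ge0 ?(ltW t0)//= ler_pdivrMl// mulr1.
  apply: Rintegral_ge => //; first by move=> y; exact: powR_ge0.
  by move=> y yt; apply: powR_anti; [exact: r_gt0|exact: r_le].
pose D := (q alpha x / B) `^ gamma.
have D0 : 0 < D by rewrite powR_gt0// divr_gt0 ?q_gt0.
have r_ub t : Theta t -> r t x `^ gamma <= D * t `^ gamma.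
  move=> Tt; have t0 := Theta_gt0 Tt.
  have -> : D * t `^ gamma = (q alpha x / B * t) `^ gamma.
    by rewrite powRM ?(ltW t0)// ltW// divr_gt0 ?q_gt0.
  apply: powR_anti.
    by rewrite mulr_gt0 ?divr_gt0 ?q_gt0.
  have := q_ub t x Tt; rewrite ler_pdivlMr// => qt.
  rewrite /r /scale_ratio ler_pdivlMr; last exact: q_gt0.
  have -> : q alpha x / B * t * scale_density p t x = q alpha x / B * (q t x * t).
    by rewrite /q; ring.
  apply: (le_trans (ler_wpM2l _ qt)); first by rewrite divr_ge0 ?ltW ?q_gt0.
  by rewrite divfK// gt_eqF.
pose E := D / c / - gamma.
have E0 : 0 < E by rewrite !divr_gt0// oppr_gt0.
exists ((1 - gamma)^-1 + gamma^-1 + E * (1 + (1 - gamma) * (2 * (Phi 2^-1 - Phi 1)))),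
  (E * ((1 - gamma) * 2)); split.
  apply: mulr_ge0; first exact: ltW.
  by apply: mulr_ge0 => //; rewrite subr_ge0 ltW// (lt_trans g0).
move=> t Tt it.
have i2 : 0 < 2^-1 :> R by rewrite invr_gt0.
have y2 : - I t <= 2 * (Phi 2^-1 - Phi 1 + Delta t).
  have := bregman_tangent_int Tt it i2.
  have -> : (2^-1 - 1) * I t = 2^-1 * - I t by field.
  by rewrite ler_pdivrMl.
have h1 := I_ub t Tt; have h2 := J t Tt; have h3 := r_ub t Tt.
have psiE : - L gamma (r t x) = gamma^-1 + r t x `^ gamma / - gamma.
  rewrite /L (powR_qlog _ gamma_neq0); move: (qlog _ _) => l.
  by field.
have h4 : r t x `^ gamma / - gamma <=
    E * (1 + (1 - gamma) * (2 * (Phi 2^-1 - Phi 1 + Delta t))).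
  rewrite /E mulrAC ler_pM2r ?invr_gt0 ?oppr_gt0//.
  apply: (le_trans h3); rewrite -mulrA ler_pM2l// ler_pdivlMl//.
  apply: (le_trans h2); rewrite lerD2l ler_pM2l// subr_gt0 (lt_trans g0)//.
rewrite psiE addrA; apply: (le_trans (lerD (lerD h1 (lexx _)) h4)).
rewrite le_eqVlt; apply/orP; left; apply/eqP.
by move: (Phi 2^-1) (Phi 1) (Delta t) => a1 a2 a3; ring.
Qed.

Let f t x := I t - L gamma (r t x).

Lemma criterion_integrable t : P0.-integrable setT (EFin \o (fun x => L gamma (r t x))) ->
  P0.-integrable setT (EFin \o f t).
Proof.
move=> it; have := integrableB measurableT (icst P0 (I t)) it.
by apply: eq_integrable.
Qed.

(** Separation and growth together: for far parameters the loss is bounded below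
and the contamination gains at most a multiple of it. *)
Lemma criterion_far x eta : 0 < eta ->
  (forall eps : R, 0 < eps ->
     exists2 N : R, 0 < N & forall u : R, N <= u -> u * p u <= eps) ->
  (exists B, forall u, p u <= B) ->
  exists2 e0 : R, 0 < e0 & forall e t : R, 0 < e -> e < e0 -> Theta t ->
    eta <= `|t - theta0| ->
    (\int[contaminate P0 x e]_y (f t y)%:E <
     \int[contaminate P0 x e]_y (f theta0 y)%:E)%E.
Proof.
move=> eta0 tail bnd.
have [d d0 hd] := criterion_separation eta0 tail.
have [a [b [b0 hab]]] := criterion_growth x bnd.
pose k := (`|a| + `|f theta0 x|) / d.
have k0 : 0 <= k by rewrite divr_ge0 ?addr_ge0// ltW.
have s0 : 0 < 1 + (1 + k + b) by rewrite ltr_pwDl// !addr_ge0.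
exists (1 + (1 + k + b))^-1; first by rewrite invr_gt0.
move=> e t e_gt0 ee Tt far.
have ek : e * (1 + k + b) < 1.
  have : e * (1 + (1 + k + b)) < 1 by rewrite -ltr_pdivlMr// div1r.
  by apply: le_lt_trans; rewrite ler_pM2l// lerDr.
have e1 : e < 1.
  apply: le_lt_trans ek; rewrite ler_peMr//; first exact: ltW.
  by rewrite -addrA lerDl addr_ge0.
have e01 : 0 < e < 1 by rewrite e_gt0.
rewrite [X in (_ < X)%E]integral_contaminate//; last first.
  exact/criterion_integrable/qlog_ratio_integrable.
(* A parameter at which the criterion is -oo cannot compete. *)
have [it|nit] := pselect (P0.-integrable setT
  (EFin \o (fun y => L gamma (r t y)))); last first.
  have [u iu hu] := criterion_ub Tt.
  rewrite (@integral_contaminate_Ny _ P0 x e (f t) u)//; first exact: ltNyr.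
    by apply: measurable_funB => //; exact: mL.
  move=> ift; apply: nit.
  have := integrableB measurableT (icst P0 (I t)) ift.
  apply: eq_integrable => // y _ /=; rewrite -EFinB; congr (_%:E).
  by rewrite /f opprB addrC subrK.
rewrite integral_contaminate//; last exact: criterion_integrable.
rewrite lte_fin; apply: (contamination_gain d0 (hd t Tt far it) b0 e_gt0 ek).
  exact: hab.
exact: criterion_gap.
Qed.

End criterion.

(** * B-robustness of the dual divergence estimator *)

Theorem proposition4 (R : realType) (p : R -> R)
    (p_gt0 : forall x, 0 < p x)
    (p_derivable : forall x, derivable p x 1)
    (p_int1 : (\int[lebesgue_measure]_x (p x)%:E = 1)%E)
    (Theta : set R) (Theta_gt0 : forall theta, Theta theta -> 0 < theta)
    (P : R -> probability (measurableTypeR R) R)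
    (P_density : forall theta, Theta theta ->
       has_density (P theta) (scale_density p theta))
    (identifiable : forall theta theta', Theta theta -> Theta theta' ->
       (forall A : set (measurableTypeR R), measurable A -> P theta A = P theta' A) ->
       theta = theta')
    (gamma : R) (gamma_neq0 : gamma != 0)
    (alpha theta0 : R) (alphaT : Theta alpha) (theta0T : Theta° theta0)
    (dphi_integrable : forall theta, Theta theta ->
       (P alpha).-integrable setT
         (EFin \o dphi_ratio (cressie_read gamma) (scale_density p) theta alpha))
    (theta0_argsup :
       is_unique_argsup Theta
         (dual_criterion (dual_m (cressie_read gamma) (scale_density p) P)
            alpha (P theta0)) theta0)
    (m_reg : m_regular Theta (P theta0) theta0
       (fun theta x =>
          dual_m (cressie_read gamma) (scale_density p) P theta alpha x))
    (A1 : (\int[lebesgue_measure]_u `|u * derive1 p u|%:E < +oo)%E)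
    (A4 : (ereal_sup (range (fun x =>
       `|derive1 (fun theta => ln (p (theta^-1 * x))) theta0
         * (p (alpha^-1 * x) / p (theta0^-1 * x)) `^ gamma|%:E)) < +oo)%E)
    (A2 : 0 < gamma ->
       (ereal_sup (range (fun x =>
          (p (alpha^-1 * x) / p (theta0^-1 * x))%:E)) < +oo)%E)
    (A3 : gamma < 0 ->
       (ereal_sup (range (fun x =>
          (p (theta0^-1 * x) / p (alpha^-1 * x))%:E)) < +oo)%E)
    (T : probability (measurableTypeR R) R -> R)
    (T_argsup : is_dual_functional Theta
       (dual_m (cressie_read gamma) (scale_density p) P) alpha T) :
  B_robust T (P theta0).
Proof.
have alpha0 : 0 < alpha := Theta_gt0 _ alphaT.
have Tth0 : Theta theta0 := interior_subset theta0T.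
have th00 : 0 < theta0 := Theta_gt0 _ Tth0.
pose m t x := dual_m (cressie_read gamma) (scale_density p) P t alpha x.
pose I t := Rintegral (P alpha) setT
  (fun y => qlog (gamma - 1) (scale_ratio p alpha t y)).
have mE t x : 0 < t -> m t x = I t - qlog gamma (scale_ratio p alpha t x).
  by move=> t0; exact: dual_mE.
case: (m_reg) => mC2 _ h0 _ _.
have near_int : \forall t \near theta0, Theta° t.
  by apply: open_nbhs_nbhs; split => //; exact: open_interior.
have m_derivable : \forall t \near theta0, forall x, derivable (m ^~ x) t 1.
  by apply: filterS near_int => t Tt x; have [d _ _] := mC2 x t Tt; exact: d.
have dm_cont x : {for theta0, continuous (derive1 (m ^~ x))}.
  have [_ d _] := mC2 x theta0 theta0T.
  exact/differentiable_continuous/derivable1_diffP/d.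
have dp_cont (u : R) : u != 0 -> {for u, continuous (derive1 p)}.
  exact: (continuous_derive1_off0 p_gt0 p_derivable alpha0 th00 mE m_derivable dm_cont).
have bnd := density_bounded p_gt0 p_derivable p_int1 A1 dp_cont.
have tail := density_tail p_gt0 p_derivable p_int1 A1 dp_cont.
have A2' : 0 < gamma -> exists K, forall x, p (alpha^-1 * x) / p (theta0^-1 * x) <= K.
  by move=> /A2/ereal_sup_range_ltyP.
have A3' : gamma < 0 -> exists K, forall x, p (theta0^-1 * x) / p (alpha^-1 * x) <= K.
  by move=> /A3/ereal_sup_range_ltyP.
have rho_bnd := powR_bounded_ratio p_gt0 gamma_neq0 A2' A3'.
have r_bnd : exists K, forall x, scale_ratio p alpha theta0 x `^ gamma <= K.
  have [K hK] := rho_bnd; exists ((theta0 / alpha) `^ gamma * K) => x.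
  by rewrite powR_scale_ratio_rho// ler_wpM2l// powR_ge0.
have dphi t : Theta t -> (P alpha).-integrable setT
    (EFin \o (fun x => qlog (gamma - 1) (scale_ratio p alpha t x))).
  move=> Tt; have := dphi_integrable t Tt.
  apply: eq_integrable => // x _; rewrite /= dphi_ratioE//; exact: Theta_gt0.
have mfun t : Theta t -> m t = fun x => I t - qlog gamma (scale_ratio p alpha t x).
  by move=> /Theta_gt0 t0; apply/funext => x; exact: mE.
have m_measurable t : Theta t -> measurable_fun setT (m t).
  move=> Tt; rewrite mfun//; apply: measurable_funB => //.
  apply: continuous_measurable_fun.
  by apply: continuous_qlog_scale_ratio => //; exact: Theta_gt0.
have m_integrable : (P theta0).-integrable setT (EFin \o m theta0).
  rewrite mfun//; apply: (@criterion_integrable _ p P).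
  exact: (@qlog_ratio_integrable _ p Theta P _ _ _ p_gt0 p_derivable Theta_gt0
    gamma_neq0 alphaT Tth0 r_bnd).
have far x (eta : R) : 0 < eta -> exists2 e0 : R, 0 < e0 &
    forall e t : R, 0 < e -> e < e0 -> Theta t -> eta <= `|t - theta0| ->
    (dual_criterion (dual_m (cressie_read gamma) (scale_density p) P) alpha
       (contaminate (P theta0) x e) t <
     dual_criterion (dual_m (cressie_read gamma) (scale_density p) P) alpha
       (contaminate (P theta0) x e) theta0)%E.
  move=> eta0.
  have [e0 e00 H] := criterion_far p_gt0 p_derivable Theta_gt0 P_density gamma_neq0
    alphaT Tth0 dphi r_bnd x eta0 tail bnd.
  exists e0 => // e t e_gt0 ee Tt ht; rewrite /dual_criterion.
  have E s : Theta s ->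
     (fun y => (dual_m (cressie_read gamma) (scale_density p) P s alpha y)%:E) =
     (fun y => (I s - qlog gamma (scale_ratio p alpha s y))%:E).
    by move=> Ts; rewrite -[LHS]/(EFin \o m s) mfun.
  rewrite (E t Tt) (E theta0 Tth0); exact: H.
have cvgIF x := @cvg_if_quotient R Theta (P theta0) theta0 alpha
  (dual_m (cressie_read gamma) (scale_density p) P) T
  theta0T m_measurable m_integrable theta0_argsup m_reg far T_argsup x.
split; first by move=> x; apply/cvg_ex; eexists; exact: cvgIF.
have IFE x : influence_function T (P theta0) x = _ := cvg_lim _ (cvgIF x).
apply/ereal_sup_range_ltyP.
have A4' := (ereal_sup_range_ltyP _).1 A4.
have [K hK] := ratio_score_bounded p_gt0 p_derivable alpha0 th00 rho_bnd A4'.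
(* The numerator of the influence function at x is its value at 0 up to a
   difference of two scores. *)
exists ((`|derive1 (m ^~ 0) theta0| + (K + K)) /
  `|Rintegral (P theta0) setT (fun y => derive1n 2 (m ^~ y) theta0)|) => x.
rewrite IFE// normf_div normrN ler_pM2r ?invr_gt0 ?normr_gt0//.
have E := nbhs_singleton (derive1_subE p_gt0 p_derivable alpha0 th00 mE m_derivable x).
have -> : derive1 (m ^~ x) theta0 = derive1 (m ^~ 0) theta0 +
   (ratio_score p alpha gamma theta0 0 - ratio_score p alpha gamma theta0 x).
  by rewrite -E addrC subrK.
rewrite (le_trans (ler_normD _ _))// lerD2l (le_trans (ler_normB _ _))//.
by rewrite lerD.
Qed.
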